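(* Let $G$ be a topological group acting properly on a space $F$, and suppose that $p:X\to B$ is an $F$-bundle between locally compact metric ANR-spaces with structure group $G$. Then $$TC(X)\le TC(B)+TC^*_G(F).$$
   Context: Topological complexity is taken in reduced form: for a space $X$, $TC(X)$ is the minimum integer $k\ge 0$ such that $X\times X$ admits an open cover $U_0,\dots,U_k$ by $k+1$ sets such that for each $i$ there is a continuous map $s_i:U_i\to X^{[0,1]}$ to the space of paths in $X$ with $s_i(x,y)(0)=x$ and $s_i(x,y)(1)=y$ for all $(x,y)\in U_i$ ($TC(X)=\infty$ if no such $k$ exists). Strongly equivariant topological complexity: if $G$ acts on a space $Y$, $TC^*_G(Y)$ is the minimal integer $k\ge 0$ such that there is an open cover of $Y\times Y$ by $(G\times G)$-invariant sets $U_0,\dots,U_k$ (for the action $(g,h)(y_0,y_1)=(gy_0,hy_1)$) such that for each $i$ there is a continuous map $\phi_i:U_i\to Y^{[0,1]}$ with $\phi_i(y_0,y_1)(0)=y_0$ and $\phi_i(y_0,y_1)(1)=y_1$ for all $(y_0,y_1)\in U_i$, which is $G$-equivariant with respect to the diagonal action of $G$ on $U_i$ and the pointwise action of $G$ on paths ($TC^*_G(Y)=\infty$ if no such $k$ exists). Proper action: an action of a topological group $G$ on a locally compact metric space $Z$ is called proper if for every compact $C\subset Z$ the set $\{g\in G\mid g(C)\cap C\neq\emptyset\}\subset G$ is compact. Structure group: let $G$ act on $F$ and let $EG\to BG$ be the projection onto the orbit space of the universal $G$-space $EG$. The universal $F$-bundle is $p_F:F\times_G EG\to BG$, where $F\times_G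 EG$ is the orbit space of the diagonal action of $G$ on $F\times EG$. An $F$-bundle $p:X\to B$ has $G$ as its structure group if there is a map $g:B\to BG$ such that $p$ is the pull-back $g^*(p_F)$ of the universal $F$-bundle. (In this case $X$ is called the twisted product over $B$ with fiber $F$ and structure group $G$.) ANR means absolute neighborhood retract. *)

(* Defs.v *)
From HB Require Import structures.
From mathcomp Require Import all_boot all_order all_algebra.
From mathcomp Require Import all_classical all_reals all_analysis.

Set Implicit Arguments.
Unset Strict Implicit.
Unset Printing Implicit Defensive.

Import Order.TTheory GRing.Theory Num.Theory.
Import numFieldNormedType.Exports.

Local Open Scope classical_set_scope.
Local Open Scope ring_scope.
Local Open Scope quotient_scope.

Definition homeomorphism (X Y : topologicalType) (f : X -> Y) :=
  continuous f /\
  exists f' : Y -> X, [/\ continuous f', cancel f f' & cancel f' f].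

Section PathSpace.
Variables (R : realType) (X : topologicalType).

Definition unit_interval : Type := set_type (`[0, 1]%classic : set R).

HB.instance Definition _ := Topological.on unit_interval.

Lemma unit_interval0_subproof : (0 : R) \in (`[0, 1]%classic : set R).
Proof. by rewrite inE /= in_itv /= lexx ler01. Qed.

Lemma unit_interval1_subproof : (1 : R) \in (`[0, 1]%classic : set R).
Proof. by rewrite inE /= in_itv /= lexx ler01. Qed.

Definition I0 : unit_interval := exist _ 0 unit_interval0_subproof.
Definition I1 : unit_interval := exist _ 1 unit_interval1_subproof.

Definition path_space : Type := continuousType unit_interval X.

HB.instance Definition _ := Choice.on path_space.

(* the compact-open topology *)
HB.instance Definition _ := Topological.copy path_space
  (@initial_topology path_space {compact-open, unit_interval -> X}
     (fun c : continuousType unit_interval X => c : unit_interval -> X)).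

Definition path_eval (c : path_space) (t : unit_interval) : X :=
  (c : continuousType unit_interval X) t.

End PathSpace.

Section TC.
Variables (R : realType) (X : topologicalType).

(* Values of s outside U are irrelevant, so taking s total is harmless:
   any map defined on U extends by constant paths. *)
Definition path_section (U : set (X * X)) (s : X * X -> path_space R X) :=
  {within U, continuous s} /\
  forall xy, U xy -> path_eval (s xy) (I0 R) = xy.1 /\
                     path_eval (s xy) (I1 R) = xy.2.

Definition TC_cover (k : nat) := exists U : 'I_k.+1 -> set (X * X),
  [/\ forall i, open (U i),
      \bigcup_i U i = [set: X * X] &
      forall i, exists s, path_section (U i) s].

(* The infimum of the empty set is +oo. *)
Definition TC : \bar R := ereal_inf [set (k%:R)%:E | k in TC_cover].

End TC.

HB.mixin Record isTopologicalGroup G of Topological G & Group G := {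
  mulg_continuous : continuous (fun xy : G * G => (xy.1 * xy.2)%g);
  invg_continuous : continuous (fun x : G => (x^-1)%g)
}.

#[short(type="topologicalGroupType")]
HB.structure Definition TopologicalGroup :=
  {G of isTopologicalGroup G & Topological G & Group G}.

Record gaction (G : topologicalGroupType) (Y : topologicalType) := GAction {
  gact :> G -> Y -> Y;
  gact1 : forall y, gact 1%g y = y;
  gactM : forall g h y, gact (g * h)%g y = gact g (gact h y);
  gact_continuous : continuous (fun gy : G * Y => gact gy.1 gy.2)
}.

Definition gmap (G : topologicalGroupType) (Y Z : topologicalType)
    (aY : gaction G Y) (aZ : gaction G Z) (f : Y -> Z) :=
  continuous f /\ forall g y, f (aY g y) = aZ g (f y).

Definition proper_gaction (G : topologicalGroupType) (Z : topologicalType)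
    (a : gaction G Z) :=
  forall C : set Z, compact C ->
    compact [set g : G | (a g @` C) `&` C !=set0].

Section TCStar.
Variables (R : realType) (G : topologicalGroupType) (Y : topologicalType).
Variable a : gaction G Y.

Definition TCstar_cover (k : nat) := exists U : 'I_k.+1 -> set (Y * Y),
  [/\ forall i, open (U i),
      forall i (g h : G) y, U i y -> U i (a g y.1, a h y.2),
      \bigcup_i U i = [set: Y * Y] &
      forall i, exists phi : Y * Y -> path_space R Y,
        path_section (U i) phi /\
        forall (g : G) y t, U i y ->
          path_eval (phi (a g y.1, a g y.2)) t = a g (path_eval (phi y) t)].

Definition TCstar : \bar R := ereal_inf [set (k%:R)%:E | k in TCstar_cover].

End TCStar.

Section OrbitSpace.
Variables (G : topologicalGroupType) (Y : topologicalType) (a : gaction G Y).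

Definition orbit_rel : rel Y := fun x y => `[< exists g, a g x = y >].

Lemma orbit_rel_refl : reflexive orbit_rel.
Proof. by move=> x; apply/asboolP; exists 1%g; rewrite gact1. Qed.

Lemma orbit_rel_sym : symmetric orbit_rel.
Proof.
suff H x y : orbit_rel x y -> orbit_rel y x by move=> x y; apply/idP/idP; apply: H.
by move=> /asboolP[g <-]; apply/asboolP; exists (g^-1)%g; rewrite -gactM mulVg gact1.
Qed.

Lemma orbit_rel_trans : transitive orbit_rel.
Proof.
move=> y x z /asboolP[g <-] /asboolP[h <-]; apply/asboolP.
by exists (h * g)%g; rewrite gactM.
Qed.

Canonical orbit_equiv :=
  EquivRel orbit_rel orbit_rel_refl orbit_rel_sym orbit_rel_trans.

Definition orbit_space : topologicalType :=
  quotient_topology {eq_quot orbit_equiv}.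

Definition orbit_proj (y : Y) : orbit_space := \pi_{eq_quot orbit_equiv} y.

Definition orbit_repr (z : orbit_space) : Y :=
  repr (z : {eq_quot orbit_equiv}).

Lemma orbit_projK z : orbit_proj (orbit_repr z) = z.
Proof. exact: (@reprK _ {eq_quot orbit_equiv}). Qed.

Lemma orbit_projP x y : orbit_proj x = orbit_proj y <-> exists g, a g x = y.
Proof.
by split=> [/eqquotP/asboolP//|?]; apply/eqquotP/asboolP.
Qed.

End OrbitSpace.

Section DiagonalAction.
Variables (G : topologicalGroupType) (F E : topologicalType).
Variables (aF : gaction G F) (aE : gaction G E).

Let dact (g : G) (z : F * E) := (aF g z.1, aE g z.2).

Lemma diag1 z : dact 1%g z = z.
Proof. by case: z => f e; rewrite /dact !gact1. Qed.

Lemma diagM g h z : dact (g * h)%g z = dact g (dact h z).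
Proof. by rewrite /dact !gactM. Qed.

Lemma diag_continuous : continuous (fun gz : G * (F * E) => dact gz.1 gz.2).
Proof.
move=> gz; apply: cvg_pair => /=.
- apply: (@continuous_comp _ _ _ (fun gz : G * (F * E) => (gz.1, gz.2.1))
    (fun gy : G * F => aF gy.1 gy.2)); last exact: (@gact_continuous _ _ aF).
  apply: cvg_pair => /=; first exact: cvg_fst.
  by apply: continuous_comp; [exact: cvg_snd|exact: cvg_fst].
- apply: (@continuous_comp _ _ _ (fun gz : G * (F * E) => (gz.1, gz.2.2))
    (fun gy : G * E => aE gy.1 gy.2)); last exact: (@gact_continuous _ _ aE).
  apply: cvg_pair => /=; first exact: cvg_fst.
  by apply: continuous_comp; [exact: cvg_snd|exact: cvg_snd].
Qed.

Definition diag_gaction : gaction G (F * E)%type :=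
  GAction diag1 diagM diag_continuous.

Definition twisted_product := orbit_space diag_gaction.

Definition twisted_proj (z : twisted_product) : orbit_space aE :=
  orbit_proj aE (orbit_repr z).2.

(* twisted_proj does not depend on the chosen representative. *)
Lemma twisted_projE f e :
  twisted_proj (orbit_proj diag_gaction (f, e)) = orbit_proj aE e.
Proof.
have /orbit_projP[g] := orbit_projK (orbit_proj diag_gaction (f, e)).
rewrite /twisted_proj; case: (orbit_repr _) => f' e' /(congr1 snd) /= <-.
by apply/orbit_projP; exists g.
Qed.

End DiagonalAction.

Section UniversalGSpace.
Variables (R : realType) (G : topologicalGroupType).

(* U is equivariantly a product G * (U / G) exactly when it admits a G-map to
   G with its left translation action. *)
Definition trivial_gset (E : topologicalType) (a : gaction G E) (U : set E) :=
  exists f : E -> G, {within U, continuous f} /\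
    forall g x, U x -> f (a g x) = (g * f x)%g.

(* The projection E -> E / G is a numerable principal G-bundle. *)
Definition numerable_free (E : topologicalType) (a : gaction G E) :=
  exists (J : choiceType) (U : J -> set (orbit_space a))
         (t : J -> orbit_space a -> R),
  [/\ forall j, open (U j) /\ trivial_gset a (orbit_proj a @^-1` U j),
      forall j, continuous (t j) /\ forall b, 0 <= t j b,
      forall j, closure [set b | t j b != 0] `<=` U j,
      forall b : orbit_space a, exists2 V, nbhs b V &
        finite_set [set j | [set b' | t j b' != 0] `&` V !=set0] &
      forall b, \sum_(j \in [set: J]) t j b = 1].

Definition ghomotopic (Y Z : topologicalType)
    (aY : gaction G Y) (aZ : gaction G Z) (f0 f1 : Y -> Z) :=
  exists H : Y * unit_interval R -> Z,
  [/\ continuous H,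
      forall y, H (y, I0 R) = f0 y,
      forall y, H (y, I1 R) = f1 y &
      forall g y t, H (aY g y, t) = aZ g (H (y, t))].

(* EG is determined up to G-homotopy equivalence: a terminal object, up to
   G-homotopy, among numerable free G-spaces. *)
Definition universal_gspace (E : topologicalType) (a : gaction G E) :=
  numerable_free a /\
  forall (E' : topologicalType) (a' : gaction G E'), numerable_free a' ->
    (exists f, gmap a' a f) /\
    forall f0 f1, gmap a' a f0 -> gmap a' a f1 -> ghomotopic a' a f0 f1.

End UniversalGSpace.

Definition fiber_bundle (F X B : topologicalType) (p : X -> B) :=
  continuous p /\
  forall b, exists U : set B, [/\ open U, U b &
    exists h : set_type (p @^-1` U) -> (set_type U * F)%type,
      homeomorphism h /\ forall x, set_val (h x).1 = p (set_val x)].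

Definition pullback (B Y C : topologicalType) (g : B -> C) (q : Y -> C) :
    topologicalType :=
  set_type [set z : B * Y | g z.1 = q z.2].

Definition pullback_proj (B Y C : topologicalType) (g : B -> C) (q : Y -> C)
  (z : pullback g q) : B := (set_val z).1.

(* Here E stands for EG and orbit_space aE for BG. *)
Definition has_structure_group (G : topologicalGroupType)
    (F E X B : topologicalType) (aF : gaction G F) (aE : gaction G E)
    (p : X -> B) :=
  exists g : B -> orbit_space aE, continuous g /\
  exists h : X -> pullback g (@twisted_proj G F E aF aE),
    homeomorphism h /\ forall x, pullback_proj (h x) = p x.

(* Absolute neighborhood retract for the class of metric spaces.  The
   retraction is a map Y -> Y so that X may be empty. *)
Definition ANR (R : realType) (X : topologicalType) :=
  forall (Y : metricType R) (i : X -> Y),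
    closed (range i) ->
    homeomorphism
      (fun x => exist _ (i x) (mem_set (imageT i x)) : set_type (range i)) ->
  exists (U : set Y) (r : Y -> Y),
    [/\ open U, range i `<=` U, {within U, continuous r},
        r @` U `<=` range i & forall x, r (i x) = i x].

(* Main.v *)
Require Import Defs.
From mathcomp Require Import all_boot all_order all_algebra.
From mathcomp Require Import all_classical all_reals all_analysis.
From mathcomp Require Import wochoice lra zify.
Import Order.TTheory GRing.Theory Num.Theory.
Import numFieldNormedType.Exports.

(** The idea of the proof.

    Let [U] be an open subset of [B * B] with a motion planner, and [V] a
    [G * G]-invariant open subset of [F * F] with a planner equivariant for the
    diagonal action. Points of [X] are classes of pairs (coordinate in [F], frame
    in [EG]), and invariance of [V] gives a meaning to the requirement that the
    coordinates of [x] and [y] lie in [V]. If moreover [(p x, p y)] is in [U], then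
    [x] is joined to [y] in two steps. First [x] is transported along the
    planned path from [p x] to [p y], its coordinate in [F] being kept fixed; it
    arrives in the fiber of [y]. Then the planner of [F] is applied inside that
    fiber; by equivariance the result does not depend on the frame. This is
    [piece_path_section].

    Covers of [B * B] and [F * F] by [n + 1] and [m + 1] such sets therefore
    induce two open covers of [X * X] such that the intersection of any member of
    the first with any member of the second has a planner. Planners on
    disjoint open sets glue, and distance functions on the metric space
    [X * X] allow one to regroup the intersections into [n + m + 1] open sets with
    planners: this is [combine_covers].

    The transport itself is an equivariant covering homotopy theorem, [transport].
    The homotopy [K], which lives over the metric space [B * B], lifts near every
    point for the whole time interval ([liftable_loc]). Since lifts restrict to
    subsets and glue over disjoint open sets, countably many open sets over
    which [K] lifts are enough ([countable_subcover]), with functions [l n]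
    subordinate to them ([numerable_cover]). Frames are then carried forward in
    stages: during the [n]-th stage time advances from the maximum of the earlier
    functions to the maximum including [l n], along the lift over the [n]-th set. *)

Set Implicit Arguments.
Unset Strict Implicit.
Unset Printing Implicit Defensive.
Local Open Scope classical_set_scope.
Local Open Scope ring_scope.

(** * Relative continuity *)

Section RelativeContinuity.
Implicit Types T Y Z : topologicalType.

(** Restriction to a subset is kept as a predicate on total maps, which spares
    the casts between subspace types when restricted maps are composed. *)
Definition cont_on T Y (A : set T) (f : T -> Y) :=
  forall x, A x -> forall N, nbhs (f x) N -> nbhs x [set y | A y -> N (f y)].

Lemma cont_onP T Y (A : set T) (f : T -> Y) :
  {within A, continuous f} <-> cont_on A f.
Proof.
rewrite subspace_continuousP; split=> cf x Ax N.
  by move=> /(cf x Ax); rewrite /= /within /=.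
by move=> /(cf x Ax).
Qed.

Lemma continuous_cont_on T Y (A : set T) (f : T -> Y) :
  continuous f -> cont_on A f.
Proof.
move=> cf x _ N nN; have : nbhs x (f @^-1` N) := cf x N nN.
by apply: filterS => y Ny _.
Qed.

Lemma cont_onT T Y (f : T -> Y) : cont_on setT f -> continuous f.
Proof.
move=> cf x N /(cf x I) nN; suff : nbhs x (f @^-1` N) by [].
by apply: filterS nN => y; apply.
Qed.

Lemma cont_on_sub T Y (A B : set T) (f : T -> Y) :
  A `<=` B -> cont_on B f -> cont_on A f.
Proof.
move=> AB cf x /AB Bx N /(cf x Bx); apply: filterS => y /= + /AB; exact.
Qed.

Lemma cont_on_comp T Y Z (A : set T) (B : set Y) (f : T -> Y) (g : Y -> Z) :
  cont_on A f -> cont_on B g -> (forall x, A x -> B (f x)) ->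
  cont_on A (fun x => g (f x)).
Proof.
move=> cf cg AB x Ax N /(cg _ (AB _ Ax))/(cf x Ax).
by apply: filterS => y /= fN Ay; apply: fN (AB _ Ay).
Qed.

Lemma cont_on_compT T Y Z (A : set T) (f : T -> Y) (g : Y -> Z) :
  cont_on A f -> continuous g -> cont_on A (fun x => g (f x)).
Proof.
move=> cf cg; apply: (cont_on_comp (B := setT)) cf _ _ => //.
exact: continuous_cont_on.
Qed.

Lemma cont_on_pair T Y Z (A : set T) (f : T -> Y) (g : T -> Z) :
  cont_on A f -> cont_on A g -> cont_on A (fun x => (f x, g x)).
Proof.
move=> cf cg x Ax N [[P Q] /= [/(cf _ Ax) nP /(cg _ Ax) nQ] PQN].
near=> y; move=> Ay; apply: PQN; split=> /=.
  by move: Ay; near: y.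
by move: Ay; near: y.
Unshelve. all: by end_near. Qed.

Lemma cont_on_id T (A : set T) : cont_on A id.
Proof. by apply: continuous_cont_on => x. Qed.

Lemma cont_on_cst T Y (A : set T) (y : Y) : cont_on A (fun=> y).
Proof. by apply: continuous_cont_on => x; exact: cvg_cst. Qed.

Lemma cont_on_fst T Y Z (A : set T) (f : T -> Y * Z) :
  cont_on A f -> cont_on A (fun x => (f x).1).
Proof. by move=> cf; apply: cont_on_compT cf _ => x; exact: cvg_fst. Qed.

Lemma cont_on_snd T Y Z (A : set T) (f : T -> Y * Z) :
  cont_on A f -> cont_on A (fun x => (f x).2).
Proof. by move=> cf; apply: cont_on_compT cf _ => x; exact: cvg_snd. Qed.

Lemma cont_on_local T Y (A : set T) (f : T -> Y) :
  (forall x, A x -> exists N h,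
     [/\ nbhs x N, cont_on (A `&` N) h & forall y, A y -> N y -> f y = h y]) ->
  cont_on A f.
Proof.
move=> loc x Ax M; have [N [h [nN ch fh]]] := loc x Ax.
rewrite (fh x Ax (nbhs_singleton nN)) => /(ch _ (conj Ax (nbhs_singleton nN))).
apply: filterS2 nN => y Ny hM Ay; rewrite (fh y Ay Ny).
exact: hM.
Qed.

Lemma cont_on_eq T Y (A : set T) (f g : T -> Y) :
  (forall x, A x -> f x = g x) -> cont_on A g -> cont_on A f.
Proof.
move=> fg cg; apply: cont_on_local => x Ax; exists setT, g; split.
- exact: filterT.
- by apply: cont_on_sub cg => y [].
- by move=> y Ay _; exact: fg.
Qed.

(** The two closed pieces are cut out by a real function [c], time in all the
    applications; they are closed in [A], which need not be closed itself. *)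
Lemma cont_on_paste (R : realType) T Y (A : set T) (c : T -> R) (a : R)
    (f g : T -> Y) :
  continuous c ->
  cont_on (A `&` [set x | c x <= a]) f -> cont_on (A `&` [set x | a <= c x]) g ->
  (forall x, A x -> c x = a -> f x = g x) ->
  cont_on A (fun x => if c x <= a then f x else g x).
Proof.
move=> cc cf cg fg x Ax N nN.
have lef : nbhs x [set y | A y -> c y <= a -> N (f y)].
  case: (leP (c x) a) nN => cxa nN.
    have := cf x (conj Ax cxa) N nN.
    by apply: filterS => y /= + Ay ya; apply.
  have : nbhs x [set y | a < c y] by exact: cc (lt_nbhsr _).
  by apply: filterS => y /= ay _; rewrite leNgt ay.
have geg : nbhs x [set y | A y -> a <= c y -> N (g y)].
  have [ax|xa] := leP a (c x).
    have nN' : nbhs (g x) N.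
      case: ifP nN => // cxa; rewrite (fg x Ax) //.
      by apply/eqP; rewrite eq_le cxa.
    have := cg x (conj Ax ax) N nN'.
    by apply: filterS => y /= + Ay ya; apply.
  have : nbhs x [set y | c y < a] by exact: cc (lt_nbhsl _).
  by apply: filterS => y /= ay _; rewrite leNgt ay.
near=> y; move=> Ay; case: (leP (c y) a) => ya.
  by move: Ay ya; near: y.
by move/ltW: ya; move: Ay; near: y.
Unshelve. all: by end_near. Qed.

(** Disjoint open pieces impose no compatibility. The map [d] only fills in
    values off the union, so that the family may be empty. *)
Lemma cont_on_bigcup_disjoint T Y (I : Type) (V : I -> set T) (f : I -> T -> Y)
    (d : T -> Y) :
  (forall i, open (V i)) -> (forall i j x, V i x -> V j x -> i = j) ->
  (forall i, cont_on (V i) (f i)) ->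
  exists2 g : T -> Y, cont_on (\bigcup_i V i) g &
    forall i x, V i x -> g x = f i x.
Proof.
move=> oV disj cf.
pose g x := match pselect (exists i, V i x) with
  | left e => f (projT1 (cid e)) x | right _ => d x end.
have gE i x : V i x -> g x = f i x.
  rewrite /g => Vix; case: pselect => [e|]; last by case; exists i.
  by rewrite (disj _ _ _ (projT2 (cid e)) Vix).
exists g => //; apply: cont_on_local => x [i _ Vix].
exists (V i), (f i); split; last by move=> y _; exact: gE.
  by apply: open_nbhs_nbhs; split.
by apply: cont_on_sub (cf i) => y [].
Qed.

Lemma open_setX T Y (A : set T) (B : set Y) :
  open A -> open B -> open (A `*` B).
Proof.
move=> oA oB; rewrite openE => -[x y] [/= Ax By].
by exists (A, B) => //; split; exact: open_nbhs_nbhs.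
Qed.

(** Orbit projections are open, and openness, unlike the property of being a
    quotient map, survives products: this is what makes
    [open_map_cont_on] available for maps out of products of orbit spaces. *)
Definition open_map T Y (q : T -> Y) :=
  forall x A, nbhs x A -> nbhs (q x) (q @` A).

Lemma open_map_id T : open_map (@id T).
Proof. by move=> x A; rewrite image_id. Qed.

Lemma open_map_pair T Y T' Y' (q : T -> Y) (q' : T' -> Y') :
  open_map q -> open_map q' ->
  open_map (fun x : T * T' => (q x.1, q' x.2)).
Proof.
move=> oq oq' [x x'] A [[P Q] /= [/oq nP /oq' nQ] PQA].
exists (q @` P, q' @` Q) => //= -[y y'] [/= [a Pa <-] [b Qb <-]].
by exists (a, b) => //; apply: PQA.
Qed.

(** Continuity descends along an open surjection, even relative to a subset
    of the target. *)
Lemma open_map_cont_on T Y Z (q : T -> Y) (A : set Y) (f : Y -> Z) :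
  open_map q -> (forall y, exists x, q x = y) ->
  cont_on (q @^-1` A) (fun x => f (q x)) -> cont_on A f.
Proof.
move=> oq sq cf y Ay N nN; have [x xy] := sq y; subst y.
have /oq := cf x Ay N nN.
by apply: filterS => _ [x' /= fN <-].
Qed.

End RelativeContinuity.

(** * Paths as homotopies *)

Section PathHomotopy.
Variable R : realType.
Implicit Types X Z : topologicalType.

(** Homotopies are parametrised by all of [R] and times are clamped to the unit
    interval: chopping and gluing in time then needs no membership proofs. *)
Definition clamp (t : R) : R := Num.max 0 (Num.min t 1).

Lemma clamp_itv (t : R) : clamp t \in (`[0, 1]%classic : set R).
Proof.
rewrite inE /= in_itv /= /clamp le_max lexx /= ge_max ler01 /=.
by rewrite ge_min lexx orbT.
Qed.

Definition clampI (t : R) : unit_interval R := exist _ (clamp t) (clamp_itv t).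

Lemma clamp_continuous : continuous clamp.
Proof.
move=> t; rewrite /clamp.
apply: (@continuous_max _ _ (fun=> 0) (fun t : R => Num.min t 1)).
  exact: cvg_cst.
by apply: continuous_min; [exact: cvg_id|exact: cvg_cst].
Qed.

Lemma clampI_continuous : continuous clampI.
Proof.
apply: (@continuous_comp_initial _ _ _ set_val clampI).
exact: clamp_continuous.
Qed.

Lemma clamp0 t : t <= 0 -> clamp t = 0.
Proof.
by move=> t0; rewrite /clamp min_l ?max_l // (le_trans t0 ler01).
Qed.

Lemma clamp1 t : 1 <= t -> clamp t = 1.
Proof. by move=> t1; rewrite /clamp min_r // max_r. Qed.

Lemma clampI0 t : t <= 0 -> clampI t = I0 R.
Proof. by move=> t0; apply: val_inj; exact: clamp0. Qed.

Lemma clampI1 t : 1 <= t -> clampI t = I1 R.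
Proof. by move=> t1; apply: val_inj; exact: clamp1. Qed.

Lemma clampIK (t : unit_interval R) : clampI (set_val t) = t.
Proof.
apply: val_inj; case: t => t /= ti; rewrite set_valE /=.
have := ti; rewrite inE /= in_itv /= => /andP[t0 t1].
by rewrite /clamp min_l // max_r.
Qed.

Lemma path_eval_continuous X (c : path_space R X) : continuous (path_eval c).
Proof. by case: c => f [[cf]]. Qed.

(** Evaluation of paths is jointly continuous because every time has compact
    neighbourhoods in the interval; the one used is the image under [clampI] of
    a short segment. *)
Lemma path_eval_cont_on Z X (A : set Z) (s : Z -> path_space R X) :
  cont_on A s ->
  cont_on (A `*` [set: R]) (fun zt => path_eval (s zt.1) (clampI zt.2)).
Proof.
move=> cs [z t] [/= Az _] N; rewrite nbhsE => -[W [oW Wc] WN].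
have cc : continuous (fun t => path_eval (s z) (clampI t)).
  move=> r; apply: (@continuous_comp _ _ _ clampI (path_eval (s z))).
    exact: clampI_continuous.
  exact: path_eval_continuous.
have /nbhs_ballP[e /= e0 eW] : nbhs t [set t | W (path_eval (s z) (clampI t))].
  by apply: (cc t); apply: open_nbhs_nbhs; split.
pose K := clampI @` `[t - e / 2, t + e / 2]%classic.
have cK : compact K.
  apply: continuous_compact; last exact: segment_compact.
  by apply: continuous_subspaceT; exact: clampI_continuous.
have nK : nbhs (s z) [set c : path_space R X | path_eval c @` K `<=` W].
  exists [set c | path_eval c @` K `<=` W]; split => //=.
    exists [set f : {compact-open, unit_interval R -> X} | f @` K `<=` W] => //.
    exact: compact_open_open.
  move=> _ [_ [r /= rt <-] <-]; apply: eW.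
  move: rt; rewrite /= in_itv /= /ball /= => /andP[r1 r2].
  rewrite ltr_norml; apply/andP; split; lra.
exists ([set z' | A z' -> path_eval (s z') @` K `<=` W], ball t (e / 2)) => /=.
  split; first exact: cs nK.
  by apply: nbhsx_ballx; rewrite divr_gt0.
move=> [z' r] [/= sW tr] [Az' _]; apply: WN; apply: sW => //.
exists (clampI r) => //; exists r => //=.
move: tr; rewrite /ball /= in_itv /= ltr_norml => /andP[r1 r2].
apply/andP; split; lra.
Qed.

(** The converse of [path_eval_cont_on]: by the tube lemma, a homotopy that maps
    a compact set of times into an open set still does so for nearby
    parameters. *)
Lemma path_of_homotopy Z X (A : set Z) (H : Z * R -> X) (d : Z -> X) :
  cont_on (A `*` [set: R]) H ->
  exists2 s : Z -> path_space R X, cont_on A s &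
    forall z t, A z -> path_eval (s z) t = H (z, set_val t).
Proof.
move=> cH.
have cHz z : A z -> continuous (fun t : unit_interval R => H (z, set_val t)).
  move=> Az; apply: cont_onT.
  apply: (cont_on_comp (f := fun t => (z, set_val t)) _ cH) => //.
  apply: cont_on_pair; first exact: cont_on_cst.
  apply: continuous_cont_on; exact: initial_continuous.
pose s z : path_space R X :=
  match pselect (A z) with
  | left Az => mkcts (cHz z Az) | right _ => cst (d z) end.
have sE z t : A z -> path_eval (s z) t = H (z, set_val t).
  by move=> Az; rewrite /s; case: pselect.
exists s => // z Az N [_ [[V oV <-] Vs] VN].
have nV : nbhs (path_eval (s z) : {compact-open, unit_interval R -> X}) V.
  by apply: (@open_nbhs_nbhs {compact-open, unit_interval R -> X}); split.
suff cs : path_eval (s y) @[y --> within A (nbhs z)] -->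
    (path_eval (s z) : {compact-open, unit_interval R -> X}).
  have : nbhs z [set y | A y -> V (path_eval (s y))] := cs V nV.
  by apply: filterS => y /= Vy /Vy ?; apply: VN.
apply/compact_open_cvgP => K O cK oO sKO.
have /compact_near_coveringP cK' := cK.
have : \forall y \near z, K `<=` [set t | A y -> O (path_eval (s y) t)].
  apply: cK' => t Kt.
  have : nbhs (H (z, set_val t)) O.
    rewrite -sE //; apply: open_nbhs_nbhs; split => //; apply: sKO.
    by exists t.
  move=> /(cH (z, set_val t) (conj Az I)) [[P Q] /= [nP nQ] PQ].
  exists (set_val @^-1` Q, P) => /=.
    split => //; exact: initial_continuous nQ.
  move=> [t' y] [/= Qt Py] Ay; rewrite sE //.
  exact: (PQ (y, set_val t')).
apply: filterS => y /= KO Ay _ [t Kt <-]; exact: KO.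
Qed.

End PathHomotopy.

(** * Principal bundles *)

Section PrincipalBundle.
Variables (G : topologicalGroupType) (E : topologicalType) (aE : gaction G E).
Local Notation pi := (orbit_proj aE).

Lemma orbit_proj_gact g e : pi (aE g e) = pi e.
Proof. by apply/esym/orbit_projP; exists g. Qed.

Lemma orbit_proj_continuous : continuous pi.
Proof. exact: pi_continuous. Qed.

Lemma orbit_proj_surj b : exists e, pi e = b.
Proof. by exists (orbit_repr b); exact: orbit_projK. Qed.

Lemma cont_on_gact (T : topologicalType) (A : set T) (g : T -> G) (f : T -> E) :
  cont_on A g -> cont_on A f -> cont_on A (fun x => aE (g x) (f x)).
Proof.
move=> cg cf; have := cont_on_compT (cont_on_pair cg cf) (@gact_continuous _ _ aE).
exact.
Qed.

Lemma gact_continuousr g : continuous (aE g).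
Proof.
apply: cont_onT; apply: cont_on_gact; first exact: cont_on_cst.
exact: cont_on_id.
Qed.

(** The saturation of an open set is a union of translates of it. *)
Lemma orbit_proj_open : open_map pi.
Proof.
move=> e A; rewrite nbhsE => -[W [oW We] WA].
apply: (@filterS _ _ _ (pi @` W)); first by move=> _ [x /WA Ax <-]; exists x.
apply: open_nbhs_nbhs; split; last by exists e.
suff -> : open (pi @` W) = open (\bigcup_g (aE g @^-1` W)).
  apply: bigcup_open => g _; move/continuousP: (@gact_continuousr g); exact.
rewrite /open /= /quotient_open; congr open; rewrite eqEsubset; split => x /=.
  by move=> [y Wy /esym/orbit_projP[g xy]]; exists g => //=; rewrite xy.
by move=> [g _ /= Wgx]; exists (aE g x) => //; rewrite orbit_proj_gact.
Qed.

(** Charts alone are asked of the bundle: the functions subordinate to a cover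
    that enter [transport] come from the metric parameter space of the
    homotopy. *)
Definition locally_trivial := forall b : orbit_space aE,
  exists U, [/\ open U, U b & trivial_gset aE (pi @^-1` U)].

Lemma numerable_free_locally_trivial (R : realType) :
  numerable_free R aE -> locally_trivial.
Proof.
move=> [J [U [t [tU _ clU _ sum1]]]] b.
have [[j tj]|] := pselect (exists j, t j b != 0).
  exists (U j); have [oU trU] := tU j; split => //; apply: (clU j).
  exact: subset_closure.
move=> /forallNP t0; have := sum1 b; rewrite fsbig1 => [|j _].
  by move=> /esym/eqP; rewrite oner_eq0.
by apply/eqP; have /negP := t0 j; rewrite negbK.
Qed.

Hypothesis trivE : locally_trivial.

Lemma gact_free g h e : aE g e = aE h e -> g = h.
Proof.
have [U [oU Ue [f [cf fM]]]] := trivE (pi e) => gh.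
apply: (@mulIg _ (f e)); rewrite -!fM //.
by rewrite gh.
Qed.

(** The translation function of the bundle, that is the element of [G] moving [e]
    to [e'], when they lie in one orbit. *)
Definition gdiff (e e' : E) : G :=
  match pselect (exists g, aE g e = e') with
  | left gP => projT1 (cid gP) | right _ => 1%g end.

Lemma gdiffK e e' : pi e = pi e' -> aE (gdiff e e') e = e'.
Proof.
by move=> /orbit_projP ee'; rewrite /gdiff; case: pselect => // ?; case: cid.
Qed.

Lemma gdiff_gact g e : gdiff e (aE g e) = g.
Proof. by apply: (@gact_free _ _ e); rewrite gdiffK // orbit_proj_gact. Qed.

Lemma gdiff_gactr g e e' : pi e = pi e' ->
  gdiff e (aE g e') = (g * gdiff e e')%g.
Proof. by move=> /gdiffK {1}<-; rewrite -gactM gdiff_gact. Qed.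

Lemma cont_on_mulg (T : topologicalType) (A : set T) (f g : T -> G) :
  cont_on A f -> cont_on A g -> cont_on A (fun x => f x * g x)%g.
Proof.
move=> cf cg; have := cont_on_compT (cont_on_pair cf cg) (@mulg_continuous G).
exact.
Qed.

Lemma cont_on_invg (T : topologicalType) (A : set T) (f : T -> G) :
  cont_on A f -> cont_on A (fun x => (f x)^-1)%g.
Proof. by move=> cf; exact: cont_on_compT cf (@invg_continuous G). Qed.

(** In a local trivialisation [f] the translation function is the quotient
    [f e' / f e], so it inherits continuity from [f] and the group. *)
Lemma gdiff_cont_on :
  cont_on [set p : E * E | pi p.1 = pi p.2] (fun p => gdiff p.1 p.2).
Proof.
apply: cont_on_local => -[e e'] /= ee'.
have [U [oU Ue [f [/cont_onP cf fM]]]] := trivE (pi e).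
exists [set p : E * E | U (pi p.1)], (fun p => f p.2 * (f p.1)^-1)%g; split.
- apply: open_nbhs_nbhs; split => //.
  have cU : continuous (fun p : E * E => pi p.1).
    move=> p; apply: (continuous_comp (f := fst)); first exact: cvg_fst.
    exact: orbit_proj_continuous.
  by move/continuousP: cU; apply.
- apply: cont_on_mulg.
    apply: (cont_on_comp (f := snd) _ cf).
      by apply: cont_on_snd; exact: cont_on_id.
    by move=> [x y] [/= -> ].
  apply: cont_on_invg; apply: (cont_on_comp (f := fst) _ cf).
    by apply: cont_on_fst; exact: cont_on_id.
  by move=> [x y] [].
- move=> [x y] /= xy Ux; rewrite -{2}(gdiffK xy) fM //.
  by rewrite mulgK.
Qed.

Lemma cont_on_gdiff (T : topologicalType) (A : set T) (f g : T -> E) :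
  cont_on A f -> cont_on A g -> (forall x, A x -> pi (f x) = pi (g x)) ->
  cont_on A (fun x => gdiff (f x) (g x)).
Proof.
move=> cf cg fg; have := cont_on_comp (cont_on_pair cf cg) gdiff_cont_on.
exact.
Qed.

(** Dividing an arbitrary representative by its [G]-coordinate gives a value that
    depends only on the orbit. *)
Lemma local_section b : exists U (s : orbit_space aE -> E),
  [/\ open U, U b, cont_on U s & forall c, U c -> pi (s c) = c].
Proof.
have [U [oU Ub [f [/cont_onP cf fM]]]] := trivE b.
exists U, (fun c => aE (f (orbit_repr c))^-1%g (orbit_repr c)); split => //.
  apply: (open_map_cont_on orbit_proj_open orbit_proj_surj).
  apply: (cont_on_eq (g := fun e => aE (f e)^-1%g e)).
    move=> e /= Ue; have /esym/orbit_projP[g <-] := orbit_projK (pi e).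
    by rewrite fM // -gactM invgM -mulgA mulVg mulg1.
  by apply: cont_on_gact; [exact: cont_on_invg|exact: cont_on_id].
by move=> c _; rewrite orbit_proj_gact orbit_projK.
Qed.

End PrincipalBundle.

(** * Numerable covers of metric spaces *)

Section NumerableCovers.
Variables (R : realType) (Z : pseudoMetricType R).

(** The distance to the complement of [W], truncated at 1 so as to be real valued
    even where the extended distance is infinite. *)
Definition cozero_fun (W : set Z) (z : Z) : R :=
  if edist_inf (~` W) z is r%:E then Num.min r 1 else 1.

Lemma cozero_fun_lip W z z' e : 0 < e -> ball z e z' ->
  cozero_fun W z <= e + cozero_fun W z'.
Proof.
move=> e0 zz'; have dzz' := @edist_fin _ _ _ (z, z') e0 zz'.
have := edist_inf_triangle (~` W) z z'.
have := edist_inf_ge0 (~` W) z; have := edist_inf_ge0 (~` W) z'.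
rewrite /cozero_fun.
case: (edist_inf _ z') => [r'| |] // r'0; case: (edist_inf _ z) => [r| |] // r0.
- move=> /le_trans /(_ (leeD2r _ dzz')); rewrite -EFinD lee_fin => rr'.
  by rewrite /Num.min; do 2 case: ifP; move: rr'; lra.
- by move=> /le_trans /(_ (leeD2r _ dzz')).
- by move=> _; rewrite /Num.min; case: ifP; move: e0; lra.
- by move=> _; move: e0; lra.
Qed.

Lemma cozero_fun_continuous W : continuous (cozero_fun W).
Proof.
move=> z; apply/cvgrPdist_le => e e0; near=> z'.
have zz' : ball z e z' by near: z'; exact: nbhsx_ballx.
have := cozero_fun_lip W e0 zz'; have := cozero_fun_lip W e0 (ball_sym zz').
by rewrite ler_norml; lra.
Unshelve. all: by end_near. Qed.

Lemma cozero_fun_ge0 W z : 0 <= cozero_fun W z.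
Proof.
rewrite /cozero_fun; have := edist_inf_ge0 (~` W) z.
by case: edist_inf => //= r; rewrite lee_fin le_min ler01 => ->.
Qed.

Lemma cozero_fun_out W z : ~ W z -> cozero_fun W z = 0.
Proof.
by move=> Wz; rewrite /cozero_fun edist_inf0 //= min_l.
Qed.

Lemma cozero_fun_gt0 W z : open W -> W z -> 0 < cozero_fun W z.
Proof.
move=> oW Wz; have /nbhs_ballP[e /= e0 eW] : nbhs z W by exact: open_nbhs_nbhs.
have : (e%:E <= edist_inf (~` W) z)%E.
  apply: le_ereal_inf_tmp => _ [w Ww <-].
  rewrite leNgt; apply/negP => lte; apply: Ww; apply: eW.
  exact: (@edist_lt_ball _ _ _ (z, w)).
rewrite /cozero_fun; case: edist_inf => //= r; rewrite lee_fin => er.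
by rewrite lt_min ltr01 (lt_le_trans e0 er).
Qed.

Lemma cozero_funP W z : open W -> (0 < cozero_fun W z) <-> W z.
Proof.
move=> oW; split; last exact: cozero_fun_gt0.
by move=> a0; apply: contrapT => /cozero_fun_out a0'; rewrite a0' ltxx in a0.
Qed.

Section DiscreteLayers.
Variables (P : set Z -> Prop) (U : set Z).
Hypothesis P0 : P set0.
Hypothesis P_sub : forall A B, open B -> B `<=` A -> P A -> P B.
Hypothesis P_bigcup : forall V : Z -> set Z, (forall c, open (V c)) ->
  (forall c c' z, V c z -> V c' z -> c = c') -> (forall c, P (V c)) ->
  P (\bigcup_c V c).
Hypothesis P_loc : forall z, U z -> exists O, [/\ open O, O z & P O].

(** Well-order the open sets [O c] witnessing that [P] is local; for each radius,
    take around every point whose first witness contains the ball of twice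
    this radius the ball of that radius itself. Balls
    attached to different first witnesses are disjoint, for otherwise the later
    centre would lie in the earlier witness. Stability of [P] under disjoint
    unions then merges all the balls of one radius into a single set, and the
    radii 1/(n+1) suffice to cover [U]. *)
Lemma countable_subcover : exists V : nat -> set Z,
  (forall n, open (V n) /\ P (V n)) /\ U `<=` \bigcup_n V n.
Proof.
have [ O OP] : {O : Z -> set Z &
    forall c, [/\ open (O c), P (O c) & U c -> O c c]}.
  apply: (@choice _ _ (fun c Oc => [/\ open Oc, P Oc & U c -> Oc c])) => c.
  have [/P_loc[ Oc [? ? ?]]|nU] := pselect (U c); first by exists Oc.
  by exists set0; split => //; exact: open0.
have [le wo] := well_ordering_principle Z.
have woZ : wo_chain le (predT : {pred Z}) by exact: withinW.
have leanti c c' : le c c' -> le c' c -> c = c'.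
  move=> cc' c'c; apply: (wo_chain_antisymmetric woZ) => //.
  exact/andP.
have letot c c' : c = c' \/ (c <> c' /\ (le c c' \/ le c' c)).
  have [|cc'] := pselect (c = c'); first by left.
  by right; split => //; apply/orP; apply: (wo_chainW woZ).
pose r n : R := n.+1%:R^-1.
(* [x] is a centre for [c] when [c] is its first witness. *)
pose ctr n c x := ball x (r n + r n) `<=` O c /\
  forall c', c' <> c -> le c' c -> ~ O c' x.
pose V n c := \bigcup_(x in [set x | ctr n c x]) (ball x (r n))°.
have r0 n : 0 < r n by rewrite invr_gt0.
have oV n c : open (V n c) by apply: bigcup_open => x _; exact: open_interior.
have disj n c c' z : V n c z -> V n c' z -> c = c'.
  have aux d d' : d <> d' -> le d d' -> V n d z -> V n d' z -> False.
    move=> dd' ldd' [x [xO _] /interior_subset xz] [x' [_ xm] /interior_subset xz'].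
    apply: (xm d) => //; apply: xO; apply: ball_triangle xz _.
    exact: ball_sym.
  move=> Vc Vc'; have [//|[cc' [lcc'|lcc']]] := letot c c'.
    by case: (aux _ _ cc' lcc').
  by case: (aux c' c) => // /esym.
exists (fun n => \bigcup_c V n c); split.
  move=> n; split; first exact: bigcup_open.
  apply: P_bigcup => // [c c' z|c]; first exact: disj.
  have [_ PO _] := OP c; apply: P_sub PO => // z [x [xO _]].
  move=> /interior_subset xz; apply: xO.
  by apply: le_ball xz; rewrite lerDl ltW.
move=> z Uz.
have [c [[/asboolP Ocz cmin] _]] : exists! c, minimum_of le [pred c | `[< O c z >]] c.
  by apply: wo; exists z; apply/asboolP; have [_ _] := OP z; apply.
have [oOc _ _] := OP c.
have /nbhs_ballP[e /= e0 eO] : nbhs z (O c) by exact: open_nbhs_nbhs.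
have [n rn] : exists n, r n + r n <= e.
  have e20 : 0 < e / 2 by rewrite divr_gt0.
  have [n _ /(_ n (leqnn _))/= rn] := near_infty_natSinv_lt (PosNum e20).
  have {}rn : r n < e / 2 := rn.
  by exists n; move: (r n) rn => rn; lra.
exists n => //; exists c => //; exists z; last exact: nbhsx_ballx.
split; first by apply: subset_trans eO; exact: le_ball.
move=> c' cc' lc'c Oc'z; apply: cc'; apply: leanti lc'c _; apply: cmin.
exact/asboolP.
Qed.

(** The cover comes with functions [l n] each vanishing near every point outside
    [V n], such that some [l n] equals 1 near any given point of [U]. Each
    layer is used with all slopes [k]: a layer containing [z] is taken to the value
    1 by a steep enough slope. *)
Lemma numerable_cover : exists (V : nat -> set Z) (l : nat -> Z -> R),
  [/\ forall n, open (V n) /\ P (V n),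
      forall n, continuous (l n),
      forall n z, 0 <= l n z <= 1,
      forall n z, V n z \/ \forall z' \near z, l n z' = 0 &
      forall z, U z -> exists n, \forall z' \near z, l n z' = 1].
Proof.
have [V [VP UV]] := countable_subcover.
(* The index [i] codes a layer and a slope. *)
pose nk i : nat * nat := odflt (0%N, 0%N) (unpickle i).
pose a n := cozero_fun (V n).
have ca n : continuous (a n) by exact: cozero_fun_continuous.
pose l i z := clamp ((nk i).2%:R * a (nk i).1 z - 1).
exists (fun i => V (nk i).1), l; split => //.
- move=> i z; apply: (@continuous_comp _ _ _ (fun z => (nk i).2%:R * a (nk i).1 z - 1)
    (@clamp R)).
    apply: cvgB; last exact: cvg_cst.
    by apply: cvgM; [exact: cvg_cst|exact: ca].
  exact: clamp_continuous.
- move=> i z; rewrite /l; have := clamp_itv ((nk i).2%:R * a (nk i).1 z - 1).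
  by rewrite inE /= in_itv.
- move=> i z; have [|nV] := pselect (V (nk i).1 z); first by left.
  right; pose b := ((nk i).2%:R + 1)^-1 : R.
  have b0 : 0 < b by rewrite invr_gt0 ltr_wpDl.
  have : nbhs z [set z' | a (nk i).1 z' < b].
    by apply: (ca _ z [set x | x < b] (lt_nbhsl _)); rewrite /a cozero_fun_out.
  apply: filterS => z' /= az'; rewrite /l clamp0 //.
  rewrite subr_le0 (@le_trans _ _ ((nk i).2%:R * b)) //.
    by apply: ler_wpM2l => //; exact: ltW.
  by rewrite /b ler_pdivrMr ?ltr_wpDl // mul1r lerDl.
- move=> z /UV[n _ Vnz].
  have a0 : 0 < a n z by apply/cozero_funP => //; exact: (VP n).1.
  have [k kb] : exists k : nat, 2 / (a n z / 2) < k%:R.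
    by exists (Num.truncn (2 / (a n z / 2))).+1; exact: truncnS_gt.
  exists (pickle (n, k)).
  have : nbhs z [set z' | a n z / 2 < a n z'].
    by apply: (ca n z [set x | a n z / 2 < x] (lt_nbhsr _)); move: a0; lra.
  apply: filterS => z' /= az'; rewrite /l /nk pickleK /= clamp1 //.
  rewrite lerBrDr; apply: (@le_trans _ _ (k%:R * (a n z / 2))).
    by move: kb; rewrite ltr_pdivrMr; [move/ltW|rewrite divr_gt0].
  by apply: ler_wpM2l => //; exact: ltW.
Qed.

End DiscreteLayers.

End NumerableCovers.

(** * Local lifts of a homotopy *)

(** Throughout, [K] is a homotopy of maps from [U] to the base of a principal
    bundle. Lifts of [K] here are continuous maps to the total space over [K],
    that is, trivialisations of the bundle pulled back along [K]; no initial
    condition is imposed, so that they can be glued by translating with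
    elements of [G]. *)
Section HomotopyLifting.
Variables (R : realType) (G : topologicalGroupType) (E : topologicalType).
Variable aE : gaction G E.
Hypothesis trivE : locally_trivial aE.
Local Notation pi := (orbit_proj aE).
Variables (Z : pseudoMetricType R) (U : set Z) (K : Z * R -> orbit_space aE).
Hypothesis oU : open U.
Hypothesis cK : cont_on (U `*` [set: R]) K.
Hypothesis K_clamp : forall z t, K (z, t) = K (z, clamp t).

Definition lift_on (A : set (Z * R)) (s : Z * R -> E) :=
  cont_on A s /\ forall zt, A zt -> pi (s zt) = K zt.

Lemma lift_on_sub A B s : A `<=` B -> lift_on B s -> lift_on A s.
Proof.
by move=> AB [cs sK]; split=> [|zt /AB]; [exact: cont_on_sub cs|exact: sK].
Qed.

Definition liftable (V : set Z) :=
  V `<=` U /\ exists s, lift_on (V `*` [set: R]) s.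

Lemma liftable0 : liftable set0.
Proof.
by split => //; exists (fun zt => orbit_repr (K zt)); split => [zt []|zt []].
Qed.

Lemma liftable_sub V W : W `<=` V -> liftable V -> liftable W.
Proof.
move=> WV [VU [s sV]]; split; first exact: subset_trans VU.
by exists s; apply: lift_on_sub sV => zt [/WV].
Qed.

Lemma liftable_bigcup (I : Type) (V : I -> set Z) : (forall i, open (V i)) ->
  (forall i j z, V i z -> V j z -> i = j) -> (forall i, liftable (V i)) ->
  liftable (\bigcup_i V i).
Proof.
move=> oV disj good; split; first by move=> z [i _]; have [VU _] := good i; exact: VU.
have [s sV] := @choice _ _ _ (fun i => (good i).2).
have [| | |g cg gE] := @cont_on_bigcup_disjoint _ _ I (fun i => V i `*` [set: R])
    s (fun zt => orbit_repr (K zt)).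
- by move=> i; apply: open_setX => //; exact: openT.
- by move=> i j zt [Vi _] [Vj _]; exact: disj Vi Vj.
- by move=> i; exact: (sV i).1.
exists g; split.
  by apply: cont_on_sub cg => zt [[i _ Vi] _]; exists i.
by move=> zt [[i _ Vi] _]; rewrite (gE i) //; apply: (sV i).2.
Qed.

Lemma lift_chart z a : U z -> exists e V s, [/\ 0 < e, open V, V z, V `<=` U &
  lift_on (V `*` [set t | a - e < t < a + e]) s].
Proof.
move=> Uz; have [N [s [oN Nza cs sK]]] := local_section trivE (K (z, a)).
have [] := cK (conj Uz I : (U `*` setT) (z, a)) (open_nbhs_nbhs (conj oN Nza)).
move=> [P Q] /= [nP /nbhs_ballP[e /= e0 eQ]] PQ.
have KN zt : ((P° `&` U) `*` [set t | a - e < t < a + e]) zt -> N (K zt).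
  case: zt => z' t [/= [/interior_subset Pz' Uz'] /andP[t1 t2]].
  apply: (PQ (z', t)) => //; split => //=; apply: eQ.
  by rewrite /ball /= ltr_norml; lra.
exists e, (P° `&` U), (fun zt => s (K zt)); split => //.
- by apply: openI => //; exact: open_interior.
- split.
    by apply: (cont_on_comp (B := N)) cs _ => //; apply: cont_on_sub cK => zt [[]].
  by move=> zt /KN; exact: sK.
Qed.

Definition lift_upto z t := exists V s,
  [/\ open V, V z, V `<=` U & lift_on (V `*` [set r | r <= t]) s].

Lemma lift_upto_le z t t' : t' <= t -> lift_upto z t -> lift_upto z t'.
Proof.
move=> t't [V [s [oV Vz VU sV]]]; exists V, s; split => //.
by apply: lift_on_sub sV => zr [? /= rt']; split => //=; exact: le_trans t't.
Qed.

Lemma lift_upto0 z : U z -> lift_upto z 0.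
Proof.
move=> /(lift_chart 0)[e [V [s [e0 oV Vz VU [cs sK]]]]].
exists V, (fun zt => s (zt.1, 0)); split => //; split.
  apply: (cont_on_comp (f := fun zt : Z * R => (zt.1, 0 : R)) _ cs).
    by apply: cont_on_pair; [apply: cont_on_fst; exact: cont_on_id|exact: cont_on_cst].
  by move=> [z' t] [Vz' _]; split => //=; lra.
move=> [z' t] [/= Vz' t0]; rewrite sK; last by split => //=; lra.
by rewrite [RHS]K_clamp clamp0.
Qed.

(** Inside one chart around time [a], a lift up to [t] is prolonged by the lift
    given by the chart, translated so that both agree at time [t]. *)
Lemma lift_upto_step z a : U z -> exists2 e, 0 < e & forall t t',
  a - e < t < a + e -> t' < a + e -> lift_upto z t -> lift_upto z t'.
Proof.
move=> /(lift_chart a)[e [V [s [e0 oV Vz VU [cs sK]]]]].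
exists e => // t t' te t'e [V' [s' [oV' V'z V'U [cs' s'K]]]].
pose A := (V `&` V') `*` [set r | r <= t'].
exists (V `&` V'), (fun zr => if zr.2 <= t then s' zr else
    aE (gdiff aE (s (zr.1, t)) (s' (zr.1, t))) (s zr)); split => //.
- exact: openI.
- by move=> x [/VU].
have ct B : cont_on B (fun zr : Z * R => (zr.1, t)).
  by apply: cont_on_pair; [apply: cont_on_fst; exact: cont_on_id|exact: cont_on_cst].
have eqt x : (V `&` V') x -> pi (s (x, t)) = pi (s' (x, t)).
  move=> [Vx V'x]; transitivity (K (x, t)); first by apply: sK; split.
  by apply/esym/s'K; split => /=.
split; last first.
  move=> [x r] [/= [Vx V'x] rt']; case: ifPn => rt; first by rewrite s'K.
  rewrite orbit_proj_gact sK //; split => //=; rewrite -ltNge in rt.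
  by move: te rt; lra.
apply: (@cont_on_paste _ _ _ _ snd t s' (fun zr =>
  aE (gdiff aE (s (zr.1, t)) (s' (zr.1, t))) (s zr))).
- by move=> zr; exact: cvg_snd.
- by apply: cont_on_sub cs' => -[x r] [[[Vx V'x] /= _] /= rt].
- apply: cont_on_gact.
    apply: cont_on_gdiff => //.
    + apply: (cont_on_comp (ct _) cs) => -[x r] [[[Vx V'x] _] _]; exact.
    + apply: (cont_on_comp (ct _) cs') => -[x r] [[[Vx V'x] _] _]; split => //=.
    + by move=> [x r] [[/= Vx _] _]; exact: eqt.
  apply: cont_on_sub cs => -[x r] [[[Vx V'x] /= rt'] /= rt]; split => //=.
  by move: te; lra.
- by move=> [x r] [/= Vx _] /= ->; rewrite gdiffK //; exact: eqt.
Qed.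

(** The supremum of the times up to which [K] lifts near [z] can be passed by
    [lift_upto_step], so it cannot stay below 1. *)
Lemma lift_upto1 z : U z -> lift_upto z 1.
Proof.
move=> Uz; apply: contrapT => n1.
have S0 : lift_upto z 0 by exact: lift_upto0.
have hS : has_sup (lift_upto z).
  split; first by exists 0.
  exists 1 => t /= tS; rewrite leNgt; apply/negP => t1; apply: n1.
  by apply: lift_upto_le tS; exact: ltW.
(* A time closer than [e] below the supremum can be prolonged past it. *)
have [e e0 step] := lift_upto_step (sup (lift_upto z)) Uz.
have [t tS te] := sup_adherent e0 hS.
have tsup : t <= sup (lift_upto z) by apply: sup_upper_bound.
have : lift_upto z (sup (lift_upto z) + e / 2).
  by apply: (step t) => //; lra.
by move=> /(sup_upper_bound hS); lra.
Qed.

Lemma liftable_loc z : U z -> exists V, [/\ open V, V z & liftable V].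
Proof.
move=> /lift_upto1[V [s [oV Vz VU [cs sK]]]]; exists V; split => //; split => //.
exists (fun zt => s (zt.1, clamp zt.2)); split.
  apply: (cont_on_comp (f := fun zt : Z * R => (zt.1, clamp zt.2)) _ cs).
    apply: cont_on_pair; first by apply: cont_on_fst; exact: cont_on_id.
    apply: cont_on_compT; first by apply: cont_on_snd; exact: cont_on_id.
    exact: clamp_continuous.
  move=> [z' t] [Vz' _]; split => //=; have := clamp_itv t.
  by rewrite inE /= in_itv /= => /andP[].
move=> [z' t] [/= Vz' _]; rewrite sK -?K_clamp //; split => //=.
by have := clamp_itv t; rewrite inE /= in_itv /= => /andP[].
Qed.

End HomotopyLifting.

(** * Parallel transport along a homotopy *)

Section Transport.
Variables (R : realType) (G : topologicalGroupType) (E : topologicalType).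
Variable aE : gaction G E.
Hypothesis trivE : locally_trivial aE.
Local Notation pi := (orbit_proj aE).
Variables (Z : pseudoMetricType R) (U : set Z) (K : Z * R -> orbit_space aE).
Hypothesis oU : open U.
Hypothesis cK : cont_on (U `*` [set: R]) K.
Hypothesis K_clamp : forall z t, K (z, t) = K (z, clamp t).

(** The principal bundle pulled back along the start of the homotopy, with a time
    parameter. *)
Definition over_start : set (Z * R * E) :=
  [set x | U x.1.1 /\ pi x.2 = K (x.1.1, 0)].

Section Stages.
Variables (V : nat -> set Z) (l : nat -> Z -> R) (s : nat -> Z * R -> E).
Hypothesis oV : forall n, open (V n).
Hypothesis sV : forall n, lift_on K (V n `*` [set: R]) (s n).
Hypothesis cl : forall n, continuous (l n).
Hypothesis l01 : forall n z, 0 <= l n z <= 1.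
Hypothesis l0 : forall n z, V n z \/ \forall z' \near z, l n z' = 0.

(** When the [l n] come from [numerable_cover], these times increase with [n] and
    reach 1 after finitely many steps, locally uniformly in [z]. The map [stage n]
    carries points up to time [stage_time n z]; on [V n], stage [n.+1] goes on
    along the lift [s n], keeping the [G]-coordinate with respect to that lift
    constant. *)
Fixpoint stage_time n z : R :=
  if n is n'.+1 then Num.max (stage_time n' z) (l n' z) else 0.

Fixpoint stage n (x : Z * R * E) : E :=
  if n is n'.+1 then
    if `[< V n' x.1.1 >] then
      aE (gdiff aE (s n' (x.1.1, Num.min x.1.2 (stage_time n' x.1.1)))
            (stage n' x))
         (s n' (x.1.1, Num.min x.1.2 (stage_time n x.1.1)))
    else stage n' x
  else x.2.

Lemma stage_time_continuous n : continuous (stage_time n).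
Proof.
elim: n => [|n IHn] z; first exact: cvg_cst.
by apply: (@continuous_max R Z (stage_time n) (l n)); [exact: IHn|exact: cl].
Qed.

Lemma stage_time_itv n z : 0 <= stage_time n z <= 1.
Proof.
elim: n => [|n /andP[n0 n1]] /=; first by rewrite lexx ler01.
by have /andP[l0' l1] := l01 n z; rewrite le_max n0 ge_max n1.
Qed.

Lemma stage_timeS_out n (z : Z) : (\forall z' \near z, l n z' = 0) ->
  \forall z' \near z, stage_time n.+1 z' = stage_time n z'.
Proof.
apply: filterS => z' /= ->; apply: max_l.
by have /andP[] := stage_time_itv n z'.
Qed.

Lemma pi_s n z t : V n z -> pi (s n (z, t)) = K (z, t).
Proof. by move=> Vz; apply: (sV n).2. Qed.

Lemma stage_over n x : over_start x ->
  pi (stage n x) = K (x.1.1, Num.min x.1.2 (stage_time n x.1.1)).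
Proof.
move=> [Ux xK]; elim: n => [|n IHn] /=.
  by rewrite xK [RHS]K_clamp clamp0 // ge_min lexx orbT.
case: asboolP => Vx; first by rewrite orbit_proj_gact pi_s.
by have [//|/nbhs_singleton/= lx0] := l0 n x.1.1; rewrite IHn lx0 max_l //;
  have /andP[] := stage_time_itv n x.1.1.
Qed.

(** Near the boundary of [V n] the function [l n] vanishes and no time elapses, so
    the case distinction in [stage] causes no jump there. *)
Lemma stageS_stationary n x : over_start x ->
  stage_time n.+1 x.1.1 = stage_time n x.1.1 -> stage n.+1 x = stage n x.
Proof.
move=> Dx; rewrite /= => ->; case: asboolP => // Vx.
by rewrite gdiffK // pi_s // stage_over.
Qed.

Lemma stage_stationary n m x : over_start x -> stage_time n x.1.1 = 1 ->
  (n <= m)%N -> stage m x = stage n x.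
Proof.
move=> Dx n1 nm.
suff [] : stage_time m x.1.1 = 1 /\ stage m x = stage n x by [].
elim: m nm => [|m IHm]; first by rewrite leqn0 => /eqP <-.
rewrite leq_eqVlt => /predU1P[<- //|/IHm[m1 <-]].
have m1' : stage_time m.+1 x.1.1 = 1.
  by rewrite /= m1 max_l //; have /andP[] := l01 m x.1.1.
by split => //; apply: stageS_stationary => //; rewrite m1'.
Qed.

Lemma stage_cont_on n : cont_on over_start (stage n).
Proof.
elim: n => [|n IHn]; first by apply: cont_on_snd; exact: cont_on_id.
apply: cont_on_local => x Dx; have [Vx|lx0] := l0 n x.1.1.
- exists [set y | V n y.1.1], (fun x => 
      aE (gdiff aE (s n (x.1.1, Num.min x.1.2 (stage_time n x.1.1)))
            (stage n x))
         (s n (x.1.1, Num.min x.1.2 (stage_time n.+1 x.1.1)))).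
  have c1 B : cont_on B (fun x : Z * R * E => x.1.1).
    by do 2 apply: cont_on_fst; exact: cont_on_id.
  have cs k : cont_on (over_start `&` [set y | V n y.1.1])
      (fun x => s n (x.1.1, Num.min x.1.2 (stage_time k x.1.1))).
    apply: (cont_on_comp (f := fun x : Z * R * E =>
      (x.1.1, Num.min x.1.2 (stage_time k x.1.1))) _ (sV n).1); last first.
      by move=> y [_ /= Vy].
    apply: cont_on_pair => //.
    apply: (cont_on_compT (f := fun x => (x.1.2, stage_time k x.1.1))
        (g := fun p : R * R => Num.min p.1 p.2)).
      apply: cont_on_pair.
        by apply: cont_on_snd; apply: cont_on_fst; exact: cont_on_id.
      by apply: cont_on_compT => //; exact: stage_time_continuous.
    move=> p; apply: (@continuous_min _ _ fst snd); first exact: cvg_fst.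
    exact: cvg_snd.
  split.
  + have := c1 setT _ I _ (open_nbhs_nbhs (conj (oV n) Vx)).
    by apply: filterS => y; exact.
  + apply: cont_on_gact; last exact: cs.
    apply: cont_on_gdiff => //.
      by apply: cont_on_sub IHn => y [].
    by move=> y [Dy /= Vy]; rewrite pi_s // stage_over.
  + by move=> y _ Vy; rewrite /= asboolT.
- exists [set y | stage_time n.+1 y.1.1 = stage_time n y.1.1], (stage n); split.
  + have c1 : cont_on setT (fun x : Z * R * E => x.1.1).
      by do 2 apply: cont_on_fst; exact: cont_on_id.
    have := c1 x I _ (stage_timeS_out lx0).
    by apply: filterS => y /(_ I).
  + by apply: cont_on_sub IHn => y [].
  + by move=> y Dy; exact: stageS_stationary.
Qed.

Lemma stage_start n z e : over_start (z, 0, e) -> stage n (z, 0, e) = e.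
Proof.
move=> Dz; elim: n => //= n IHn; case: asboolP => // Vz; rewrite IHn.
have min0 k : Num.min 0 (stage_time k z) = 0.
  by apply: min_l; have /andP[] := stage_time_itv k z.
have := min0 n.+1; rewrite /= => ->; rewrite min0 gdiffK // pi_s //.
by have [_ ->] := Dz.
Qed.

Lemma stage_gact n g z t e : over_start (z, t, e) ->
  stage n (z, t, aE g e) = aE g (stage n (z, t, e)).
Proof.
move=> Dz; elim: n => //= n IHn; case: asboolP => // Vz; rewrite IHn.
by rewrite gdiff_gactr ?gactM // pi_s // stage_over.
Qed.

End Stages.

(** Covering homotopy theorem for principal bundles, over a metric parameter
    space and in equivariant form. Near each point the stages are eventually
    constant, and their limit is the transport. *)
Theorem transport : exists T : Z * R * E -> E, [/\ cont_on over_start T,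
  forall z t e, over_start (z, t, e) -> pi (T (z, t, e)) = K (z, t),
  forall z e, over_start (z, 0, e) -> T (z, 0, e) = e &
  forall g z t e, over_start (z, t, e) -> T (z, t, aE g e) = aE g (T (z, t, e))].
Proof.
have [] := @numerable_cover R Z (liftable U K) U.
- exact: liftable0.
- by move=> A B _; exact: liftable_sub.
- by move=> V oV disj; exact: liftable_bigcup.
- by move=> z; exact: liftable_loc.
move=> V [l [VP cl l01 l0 l1]].
have [s sV] := @choice _ _ _ (fun n => (VP n).2.2).
have oV n := (VP n).1.
have timeE z : U z -> exists n, \forall z' \near z, stage_time l n z' = 1.
  move=> /l1[n ln1]; exists n.+1; apply: filterS ln1 => z' /= ->.
  by apply: max_r; have /andP[] := stage_time_itv l01 n z'.
pose T x := match pselect (exists n, stage_time l n x.1.1 = 1) with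
  | left e => stage V l s (projT1 (cid e)) x | right _ => x.2 end.
have TE n x : over_start x -> stage_time l n x.1.1 = 1 ->
    T x = stage V l s n x.
  move=> Dx n1; rewrite /T; case: pselect => [e|]; last by case; exists n.
  case: cid => m /= m1.
  have st := @stage_stationary V l s sV l01 l0.
  by have [mn|/ltnW nm] := leqP m n; [rewrite [RHS](st m)|rewrite (st n)].
exists T; split.
- apply: cont_on_local => x Dx; have [n nx] := timeE _ Dx.1.
  exists [set y | stage_time l n y.1.1 = 1], (stage V l s n); split.
  + have c1 : cont_on setT (fun x : Z * R * E => x.1.1).
      by do 2 apply: cont_on_fst; exact: cont_on_id.
    by apply: filterS (c1 x I _ nx) => y /(_ I).
  + apply: (@cont_on_sub _ _ _ over_start); first by move=> y [].
    exact: (stage_cont_on oV sV cl l01 l0).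
  + by move=> y Dy; exact: TE.
- move=> z t e Dz; have [n /nbhs_singleton/= n1] := timeE _ Dz.1.
  rewrite (TE n) // (stage_over sV l01 l0) //= n1 K_clamp [RHS]K_clamp.
  congr (K (z, _)); rewrite /clamp -minA minxx //.
- move=> z e Dz; have [n /nbhs_singleton/= n1] := timeE _ Dz.1.
  by rewrite (TE n) // (stage_start sV l01).
- move=> g z t e Dz; have [n /nbhs_singleton/= n1] := timeE _ Dz.1.
  rewrite !(TE n) //; first exact: (stage_gact sV l01 l0).
  by split; [exact: Dz.1|rewrite orbit_proj_gact; exact: Dz.2].
Qed.

End Transport.

(** * Twisted products *)

Section TwistedProduct.
Variables (R : realType) (G : topologicalGroupType) (F E : topologicalType).
Variables (aF : gaction G F) (aE : gaction G E).
Hypothesis trivE : locally_trivial aE.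
Local Notation pi := (orbit_proj aE).
Local Notation D := (twisted_product aF aE).
Local Notation quo := (orbit_proj (diag_gaction aF aE)).
Local Notation tw := (@twisted_proj G F E aF aE).

Lemma quo_gact g f e : quo (aF g f, aE g e) = quo (f, e).
Proof. exact: (@orbit_proj_gact _ _ (diag_gaction aF aE) g (f, e)). Qed.

Lemma quo_surj (d : D) : exists f e, quo (f, e) = d.
Proof.
by have [[f e] <-] := orbit_proj_surj d; exists f, e.
Qed.

Lemma quo_repr f e : exists g, orbit_repr (quo (f, e)) = (aF g f, aE g e).
Proof.
have /esym/orbit_projP[g <-] := orbit_projK (quo (f, e)).
by exists g.
Qed.

Section FiberSet.
Variable V : set (F * F).
Hypothesis oV : open V.
Hypothesis V_inv : forall (g h : G) y, V y -> V (aF g y.1, aF h y.2).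

(** The pairs of points of the twisted product whose coordinates in [F] form a
    pair in [V]. Coordinates are defined up to [G] separately for each point,
    so the invariance of [V] under [G * G] makes the choice of representatives
    irrelevant. *)
Definition fiber_set : set (D * D) :=
  [set d | V ((orbit_repr d.1).1, (orbit_repr d.2).1)].

Lemma fiber_setE f e f' e' : fiber_set (quo (f, e), quo (f', e')) <-> V (f, f').
Proof.
rewrite /fiber_set /=; have [g ->] := quo_repr f e; have [h ->] := quo_repr f' e'.
split=> [|/(V_inv g h)//] /(V_inv g^-1%g h^-1%g) /=.
by rewrite -!gactM !mulVg !gact1.
Qed.

Lemma fiber_set_open : open fiber_set.
Proof.
rewrite openE => -[d d']; have [f [e <-]] := quo_surj d.
have [f' [e' <-]] := quo_surj d'; rewrite fiber_setE => Vff.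
have [[P Q] /= [nP nQ] PQ] := open_nbhs_nbhs (conj oV Vff).
have oq := @orbit_proj_open _ _ (diag_gaction aF aE).
exists (quo @` (P `*` setT), quo @` (Q `*` setT)) => /=.
  split; apply: oq.
    by exists (P, setT) => //=; split => //; exact: filterT.
  by exists (Q, setT) => //=; split => //; exact: filterT.
move=> [_ _] /= [[[a b] [/= Pa _] <-] [[a' b'] [/= Qa' _] <-]].
by apply/fiber_setE; apply: (PQ (a, a')).
Qed.

Variable phi : F * F -> path_space R F.
Hypothesis phiV : path_section V phi.
Hypothesis phi_gact : forall (g : G) y t, V y ->
  path_eval (phi (aF g y.1, aF g y.2)) t = aF g (path_eval (phi y) t).

(** The planner [phi] of [F] acting in one fiber of the twisted product: the second
    point is first rewritten over the frame [r.2] of the first one. *)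
Definition fiber_path (x : D * D * R) : D :=
  let r := orbit_repr x.1.1 in let r' := orbit_repr x.1.2 in
  quo (path_eval (phi (r.1, aF (gdiff aE r'.2 r.2) r'.1)) (clampI x.2), r.2).

(** A common change of frame moves both coordinates by the same element of [G], so
    equivariance of [phi] under the diagonal action is what makes the path
    independent of representatives. *)
Lemma fiber_pathE f e f' e' t : pi e = pi e' -> V (f, f') ->
  fiber_path (quo (f, e), quo (f', e'), t) =
  quo (path_eval (phi (f, aF (gdiff aE e' e) f')) (clampI t), e).
Proof.
move=> ee' Vff; rewrite /fiber_path /=.
have [g ->] := quo_repr f e; have [h ->] := quo_repr f' e' => /=.
have -> : gdiff aE (aE h e') (aE g e) = (g * gdiff aE e' e * h^-1)%g.
  apply: (@gact_free _ _ _ trivE _ _ (aE h e')).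
  rewrite gdiffK ?orbit_proj_gact // -!gactM -!mulgA mulVg mulg1 gactM.
  by rewrite gdiffK.
rewrite -gactM -!mulgA mulVg mulg1 gactM.
rewrite (phi_gact g (clampI t) (y := (f, aF (gdiff aE e' e) f'))).
  by rewrite quo_gact.
by have := V_inv 1%g (gdiff aE e' e) Vff; rewrite /= gact1.
Qed.

Lemma V_transport f f' k : V (f, f') -> V (f, aF k f').
Proof. by move=> /(V_inv 1%g k) /=; rewrite gact1. Qed.

Lemma fiber_path_cont_on :
  cont_on [set x : D * D * R | tw x.1.1 = tw x.1.2 /\ fiber_set x.1] fiber_path.
Proof.
have oq := @orbit_proj_open _ _ (diag_gaction aF aE).
apply: (open_map_cont_on
  (open_map_pair (open_map_pair oq oq) (@open_map_id R))).
  move=> [[d d'] t]; have [f [e <-]] := quo_surj d.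
  by have [f' [e' <-]] := quo_surj d'; exists ((f, e), (f', e'), t).
pose S := [set x : (F * E) * (F * E) * R |
  pi x.1.1.2 = pi x.1.2.2 /\ V (x.1.1.1, x.1.2.1)].
apply: (@cont_on_sub _ _ _ S).
  move=> [[[f e] [f' e']] t] /= []; rewrite !twisted_projE fiber_setE.
  by split.
apply: (cont_on_eq (g := fun x => quo (path_eval
    (phi (x.1.1.1, aF (gdiff aE x.1.2.2 x.1.1.2) x.1.2.1)) (clampI x.2),
    x.1.1.2))).
  by move=> [[[f e] [f' e']] t] /= [ee' Vff]; rewrite fiber_pathE.
apply: cont_on_compT; last exact: orbit_proj_continuous.
have c2 : cont_on S (fun x => x.1.1.2).
  by apply: cont_on_snd; do 2 apply: cont_on_fst; exact: cont_on_id.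
apply: cont_on_pair => //.
have /cont_onP/path_eval_cont_on cphi := phiV.1.
apply: (cont_on_comp (f := fun x : (F * E) * (F * E) * R =>
    ((x.1.1.1, aF (gdiff aE x.1.2.2 x.1.1.2) x.1.2.1), x.2)) _ cphi).
  apply: cont_on_pair; last by apply: cont_on_snd; exact: cont_on_id.
  apply: cont_on_pair; first by do 3 apply: cont_on_fst; exact: cont_on_id.
  apply: cont_on_gact; last first.
    by apply: cont_on_fst; apply: cont_on_snd; apply: cont_on_fst; exact: cont_on_id.
  apply: cont_on_gdiff => //.
    by do 2 apply: cont_on_snd; apply: cont_on_fst; exact: cont_on_id.
  by move=> x [-> _].
move=> [[[f e] [f' e']] t] /= [ee' Vff]; split => //=; exact: V_transport.
Qed.

Lemma twisted_projP d d' : tw d = tw d' -> fiber_set (d, d') ->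
  exists f e f' e', [/\ d = quo (f, e), d' = quo (f', e'), pi e = pi e' & V (f, f')].
Proof.
have [f [e <-]] := quo_surj d; have [f' [e' <-]] := quo_surj d'.
rewrite !twisted_projE fiber_setE => ee' Vff.
by exists f, e, f', e'.
Qed.

Lemma tw_fiber_path d d' t : tw d = tw d' -> fiber_set (d, d') ->
  tw (fiber_path (d, d', t)) = tw d.
Proof.
move=> dd' Vd; have [f [e [f' [e' [-> -> ee' Vff]]]]] := twisted_projP dd' Vd.
by rewrite fiber_pathE // !twisted_projE.
Qed.

Lemma fiber_path0 d d' : tw d = tw d' -> fiber_set (d, d') ->
  fiber_path (d, d', 0) = d.
Proof.
move=> dd' Vd; have [f [e [f' [e' [-> -> ee' Vff]]]]] := twisted_projP dd' Vd.
rewrite fiber_pathE // clampI0 //.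
by have [-> _] := phiV.2 _ (V_transport (gdiff aE e' e) Vff).
Qed.

Lemma fiber_path1 d d' : tw d = tw d' -> fiber_set (d, d') ->
  fiber_path (d, d', 1) = d'.
Proof.
move=> dd' Vd; have [f [e [f' [e' [-> -> ee' Vff]]]]] := twisted_projP dd' Vd.
rewrite fiber_pathE // clampI1 //.
have [_ ->] := phiV.2 _ (V_transport (gdiff aE e' e) Vff).
by rewrite /= -{2}(gdiffK (esym ee')) quo_gact.
Qed.

End FiberSet.

Section Transport.
Variables (Z : pseudoMetricType R) (U : set Z) (K : Z * R -> orbit_space aE).
Variable T : Z * R * E -> E.
Hypothesis cT : cont_on (over_start U K) T.
Hypothesis pi_T : forall z t e, over_start U K (z, t, e) ->
  pi (T (z, t, e)) = K (z, t).
Hypothesis T0 : forall z e, over_start U K (z, 0, e) -> T (z, 0, e) = e.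
Hypothesis T_gact : forall g z t e, over_start U K (z, t, e) ->
  T (z, t, aE g e) = aE g (T (z, t, e)).

(** Transport of the frame, the coordinate in [F] staying fixed. *)
Definition twisted_transport (x : Z * R * D) : D :=
  let r := orbit_repr x.2 in quo (r.1, T (x.1, r.2)).

Definition over_start_twisted : set (Z * R * D) :=
  [set x | U x.1.1 /\ tw x.2 = K (x.1.1, 0)].

Lemma twisted_transportE z t f e : over_start U K (z, t, e) ->
  twisted_transport (z, t, quo (f, e)) = quo (f, T (z, t, e)).
Proof.
move=> ze; rewrite /twisted_transport /=; have [g ->] := quo_repr f e.
by rewrite /= T_gact // quo_gact.
Qed.

Lemma twisted_transport_cont_on : cont_on over_start_twisted twisted_transport.
Proof.
have oq := @orbit_proj_open _ _ (diag_gaction aF aE).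
apply: (open_map_cont_on (open_map_pair (@open_map_id (Z * R)%type) oq)).
  by move=> [zt d]; have [f [e <-]] := quo_surj d; exists (zt, (f, e)).
pose S := [set x : (Z * R) * (F * E) | over_start U K (x.1, x.2.2)].
apply: (@cont_on_sub _ _ _ S).
  by move=> [[z t] [f e]] /= []; rewrite /= twisted_projE.
apply: (cont_on_eq (g := fun x => quo (x.2.1, T (x.1, x.2.2)))).
  by move=> [[z t] [f e]] /= ze; rewrite twisted_transportE.
apply: cont_on_compT; last exact: orbit_proj_continuous.
apply: cont_on_pair.
  by apply: cont_on_fst; apply: cont_on_snd; exact: cont_on_id.
apply: (cont_on_comp (f := fun x : (Z * R) * (F * E) => (x.1, x.2.2)) _ cT) => //.
apply: cont_on_pair; first by apply: cont_on_fst; exact: cont_on_id.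
by do 2 apply: cont_on_snd; exact: cont_on_id.
Qed.

Lemma over_start_twistedP z t d : over_start_twisted (z, t, d) ->
  exists f e, d = quo (f, e) /\ over_start U K (z, t, e).
Proof.
have [f [e <-]] := quo_surj d; rewrite /over_start_twisted /= twisted_projE.
by exists f, e.
Qed.

Lemma tw_twisted_transport z t d : over_start_twisted (z, t, d) ->
  tw (twisted_transport (z, t, d)) = K (z, t).
Proof.
move=> /over_start_twistedP[f [e [-> ze]]].
by rewrite twisted_transportE // twisted_projE pi_T.
Qed.

Lemma twisted_transport0 z d : over_start_twisted (z, 0, d) ->
  twisted_transport (z, 0, d) = d.
Proof.
move=> /over_start_twistedP[f [e [-> ze]]].
by rewrite twisted_transportE // T0.
Qed.

Lemma fiber_set_transport (V : set (F * F)) z t d d' :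
  (forall (g h : G) y, V y -> V (aF g y.1, aF h y.2)) ->
  over_start_twisted (z, t, d) ->
  fiber_set V (d, d') -> fiber_set V (twisted_transport (z, t, d), d').
Proof.
move=> V_inv /over_start_twistedP[f [e [-> ze]]].
rewrite twisted_transportE //; have [f' [e' <-]] := quo_surj d'.
by rewrite !fiber_setE.
Qed.

End Transport.

End TwistedProduct.

(** * Motion planners on the total space *)

(** The value off [S] is read from an extra argument because [T] may be empty. *)
Lemma cont_on_partial_inverse (T Y : topologicalType) (S : set Y)
    (k : set_type S -> T) : continuous k ->
  exists2 m : T * Y -> T, cont_on [set x | S x.2] m &
    forall x y (Sy : S y), m (x, y) = k (exist _ y (mem_set Sy)).
Proof.
move=> ck.
pose m (x : T * Y) := match pselect (S x.2) with
  | left Sy => k (exist _ x.2 (mem_set Sy)) | right _ => x.1 end.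
have mE x y (Sy : S y) : m (x, y) = k (exist _ y (mem_set Sy)).
  by rewrite /m /=; case: pselect => // Sy'; congr (k (exist _ _ _)).
exists m => // -[x y] /= Sy N; rewrite (mE _ _ Sy) => /ck [_ [[W oW <-] /= Wy] WN].
exists (setT, W) => /=.
  by split; [exact: filterT|exact: open_nbhs_nbhs].
by move=> [x' y'] [/= _ Wy'] Sy'; rewrite (mE _ _ Sy'); apply: WN.
Qed.

Section TotalSpace.
Variables (R : realType) (G : topologicalGroupType) (F E : topologicalType).
Variables (aF : gaction G F) (aE : gaction G E).
Hypothesis trivE : locally_trivial aE.
Local Notation tw := (@twisted_proj G F E aF aE).
Variables (X : topologicalType) (B : pseudoMetricType R) (p : X -> B).
Variables (g : B -> orbit_space aE) (h : X -> pullback g tw).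
Variable h' : pullback g tw -> X.
Hypothesis cg : continuous g.
Hypothesis ch : continuous h.
Hypothesis ch' : continuous h'.
Hypothesis hK : cancel h h'.
Hypothesis hp : forall x, pullback_proj (h x) = p x.

Definition twisted_coord (x : X) : twisted_product aF aE := (set_val (h x)).2.

Lemma tw_coord x : tw (twisted_coord x) = g (p x).
Proof.
rewrite -hp; exact/esym/(set_mem (valP (h x))).
Qed.

Lemma val_h_continuous : continuous (fun x => set_val (h x)).
Proof.
move=> x; apply: (@continuous_comp _ _ _ h set_val); first exact: ch.
exact: initial_continuous.
Qed.

Lemma twisted_coord_continuous : continuous twisted_coord.
Proof.
apply: cont_onT; apply: cont_on_snd; apply: continuous_cont_on.
exact: val_h_continuous.
Qed.

Lemma p_continuous : continuous p.
Proof.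
rewrite (_ : p = fun x => (set_val (h x)).1); last first.
  by apply/funext => x; rewrite -hp.
apply: cont_onT; apply: cont_on_fst; apply: continuous_cont_on.
exact: val_h_continuous.
Qed.

Section Piece.
Variables (U : set (B * B)) (V : set (F * F)).
Variables (s : B * B -> path_space R B) (phi : F * F -> path_space R F).
Hypothesis oU : open U.
Hypothesis sU : path_section U s.
Hypothesis V_inv : forall (g h : G) y, V y -> V (aF g y.1, aF h y.2).
Hypothesis phiV : path_section V phi.
Hypothesis phi_gact : forall (g : G) y t, V y ->
  path_eval (phi (aF g y.1, aF g y.2)) t = aF g (path_eval (phi y) t).

Definition piece : set (X * X) := [set z |
  U (p z.1, p z.2) /\ fiber_set V (twisted_coord z.1, twisted_coord z.2)].

(** The path from [x] to [y] spends the first half of the time over the planned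
    path from [p x] to [p y], by transport, and the second half in the fiber over
    [p y], by the planner of [F]. *)
Theorem piece_path_section : exists s', path_section piece (s' : _ -> path_space R X).
Proof.
have /cont_onP/path_eval_cont_on cs := sU.1.
pose K zt := g (path_eval (s zt.1) (clampI zt.2)).
have cK : cont_on (U `*` [set: R]) K by apply: cont_on_compT cs _.
have K_clamp z t : K (z, t) = K (z, clamp t).
  by rewrite /K /= (clampIK (clampI t)).
have [T [cT pi_T T0 T_gact]] := transport trivE oU cK K_clamp.
pose tt := @twisted_transport R G F E aF aE (B * B)%type T.
pose fp := @fiber_path R G F E aF aE phi.
have [m cm mE] := cont_on_partial_inverse ch'.
pose bp (z : X * X) := (p z.1, p z.2).
pose dx (z : X * X) := twisted_coord z.1.
pose dy (z : X * X) := twisted_coord z.2.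
have K0 z : piece z -> K (bp z, 0) = g (p z.1).
  by move=> [Uz _]; rewrite /K /= clampI0 //; have [-> _] := sU.2 _ Uz.
have K1 z : piece z -> K (bp z, 1) = g (p z.2).
  by move=> [Uz _]; rewrite /K /= clampI1 //; have [_ ->] := sU.2 _ Uz.
have start z t : piece z -> over_start_twisted U K (bp z, t, dx z).
  by move=> Az; split; [exact: Az.1|rewrite /= tw_coord K0].
pose mid z := tt (bp z, 1, dx z).
have tw_mid z : piece z -> tw (mid z) = tw (dy z).
  move=> Az; rewrite /mid /tt.
  by rewrite (tw_twisted_transport pi_T T_gact (start _ _ Az)) K1 // tw_coord.
have V_mid z : piece z -> fiber_set V (mid z, dy z).
  move=> Az; apply: (fiber_set_transport T_gact V_inv (start _ _ Az)).
  exact: Az.2.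
pose H1 (x : (X * X) * R) :=
  m (x.1.1, (path_eval (s (bp x.1)) (clampI (2 * x.2)), tt (bp x.1, 2 * x.2, dx x.1))).
pose H2 (x : (X * X) * R) :=
  m (x.1.1, (p x.1.2, fp (mid x.1, dy x.1, 2 * x.2 - 1))).
pose H x := if x.2 <= 1 / 2 then H1 x else H2 x.
have m_h z y : y = set_val (h z) -> forall x, m (x, y) = z.
  move=> -> x; have Sy := set_mem (valP (h z)).
  by rewrite (mE _ _ Sy) -[RHS]hK; congr h'; apply: val_inj.
have valh z : set_val (h z) = (p z, twisted_coord z).
  by rewrite /twisted_coord -hp /pullback_proj; case: (set_val (h z)).
have cbp A : cont_on A bp.
  apply: cont_on_pair; apply: cont_on_compT p_continuous.
    by apply: cont_on_fst; exact: cont_on_id.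
  by apply: cont_on_snd; exact: cont_on_id.
have cdx A : cont_on A dx.
  apply: cont_on_compT twisted_coord_continuous.
  by apply: cont_on_fst; exact: cont_on_id.
have cdy A : cont_on A dy.
  apply: cont_on_compT twisted_coord_continuous.
  by apply: cont_on_snd; exact: cont_on_id.
have ctt := twisted_transport_cont_on (aF := aF) cT T_gact.
have cfp := fiber_path_cont_on trivE V_inv phiV phi_gact.
have cmid : cont_on piece mid.
  apply: (cont_on_comp (f := fun z => (bp z, 1 : R, dx z)) _ ctt).
    apply: cont_on_pair => //; apply: cont_on_pair => //; exact: cont_on_cst.
  by move=> z Az; exact: start.
pose A : set ((X * X) * R) := piece `*` [set: R].
have cfst (C : set ((X * X) * R)) (Y : topologicalType) (f : X * X -> Y) :
    cont_on piece f ->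
    cont_on (A `&` C) (fun x : (X * X) * R => f x.1).
  move=> cf; apply: (cont_on_comp (f := fst) _ cf).
    by apply: cont_on_fst; exact: cont_on_id.
  by move=> x [[]].
have caff (C : set ((X * X) * R)) (b : R) : cont_on C (fun x => 2 * x.2 - b).
  apply: (cont_on_compT (f := snd) (g := fun t : R => 2 * t - b)).
    by apply: cont_on_snd; exact: cont_on_id.
  move=> t; apply: cvgB; last exact: cvg_cst.
  by apply: cvgM; [exact: cvg_cst|exact: cvg_id].
have cdbl (C : set ((X * X) * R)) : cont_on C (fun x => 2 * x.2).
  by apply: (cont_on_eq _ (caff C 0)) => x _; rewrite subr0.
have cx (C : set ((X * X) * R)) : cont_on (A `&` C) (fun x : (X * X) * R => x.1.1).
  by do 2 apply: cont_on_fst; exact: cont_on_id.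
have cH1 : cont_on (A `&` [set x | x.2 <= 1 / 2]) H1.
  apply: (cont_on_comp (f := fun x : (X * X) * R =>
    (x.1.1, (path_eval (s (bp x.1)) (clampI (2 * x.2)),
       tt (bp x.1, 2 * x.2, dx x.1)))) _ cm).
    apply: cont_on_pair => //; apply: cont_on_pair.
      apply: (cont_on_comp (f := fun x : (X * X) * R => (bp x.1, 2 * x.2)) _ cs).
        by apply: cont_on_pair => //; exact: cfst.
      by move=> [z t] [[/= [Uz _] _] _].
    apply: (cont_on_comp (f := fun x : (X * X) * R => (bp x.1, 2 * x.2, dx x.1)) _ ctt).
      by do 2 (apply: cont_on_pair => //; last exact: cfst); exact: cfst.
    by move=> [z t] [[/= Az _] _]; exact: start.
  move=> [z t] [[/= Az _] _] /=.
  by rewrite (tw_twisted_transport pi_T T_gact (start _ _ Az)).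
have cH2 : cont_on (A `&` [set x | 1 / 2 <= x.2]) H2.
  apply: (cont_on_comp (f := fun x : (X * X) * R =>
    (x.1.1, (p x.1.2, fp (mid x.1, dy x.1, 2 * x.2 - 1)))) _ cm).
    apply: cont_on_pair => //; apply: cont_on_pair.
      apply: (cfst _ _ (fun z => p z.2)); apply: cont_on_compT p_continuous.
      by apply: cont_on_snd; exact: cont_on_id.
    apply: (cont_on_comp (f := fun x : (X * X) * R =>
      (mid x.1, dy x.1, 2 * x.2 - 1)) _ cfp).
      by apply: cont_on_pair => //; apply: cont_on_pair; exact: cfst.
    by move=> [z t] [[/= Az _] _]; split; [exact: tw_mid|exact: V_mid].
  move=> [z t] [[/= Az _] _] /=.
  rewrite (tw_fiber_path trivE V_inv phi_gact) ?tw_mid ?tw_coord //.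
  exact: V_mid.
have H12 x : A x -> x.2 = 1 / 2 -> H1 x = H2 x.
  case: x => z t [/= Az _] ->; rewrite /H1 /H2 /=.
  have -> : 2 * (1 / 2) = 1 :> R by lra.
  rewrite subrr clampI1 // (sU.2 _ Az.1).2 /= /fp.
  by rewrite (fiber_path0 trivE V_inv phiV phi_gact) ?tw_mid //; exact: V_mid.
have cH : cont_on A H.
  by apply: cont_on_paste => // x; exact: cvg_snd.
have [s' cs' s'E] := path_of_homotopy (fun z => z.1) cH.
exists s'; split; first exact/cont_onP.
move=> z Az; rewrite !s'E // /H /=; split.
  rewrite (_ : set_val (I0 R) = 0) // ifT; last by lra.
  rewrite /H1 /=; apply: m_h; rewrite mulr0 valh clampI0 //.
  by rewrite (sU.2 _ Az.1).1 /tt (twisted_transport0 T0 T_gact (start _ _ Az)).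
rewrite (_ : set_val (I1 R) = 1) // ifF; last by apply/negP; lra.
rewrite /H2 /=; apply: m_h; rewrite valh mulr1.
have -> : 2 - 1 = 1 :> R by lra.
rewrite /fp (fiber_path1 trivE V_inv phiV phi_gact) ?tw_mid //.
exact: V_mid.
Qed.

End Piece.

Lemma fiber_set_coord_open V : open V ->
  (forall (g h : G) y, V y -> V (aF g y.1, aF h y.2)) ->
  open [set z : X * X | fiber_set V (twisted_coord z.1, twisted_coord z.2)].
Proof.
move=> oV V_inv.
have c2 : continuous (fun z : X * X => (twisted_coord z.1, twisted_coord z.2)).
  apply: cont_onT; apply: cont_on_pair;
    apply: cont_on_compT twisted_coord_continuous.
    by apply: cont_on_fst; exact: cont_on_id.
  by apply: cont_on_snd; exact: cont_on_id.
move/continuousP: c2 => /(_ (fiber_set V)); apply.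
by apply: fiber_set_open.
Qed.

End TotalSpace.

(** * Combining two covers *)

Section CombineCovers.
Variables (R : realType) (Z : pseudoMetricType R) (P : set Z -> Prop).
Hypothesis P_sub : forall A B, B `<=` A -> P A -> P B.
Hypothesis P_bigcup : forall (I : finType) (V : I -> set Z),
  (forall i, open (V i)) -> (forall i j z, V i z -> V j z -> i = j) ->
  (forall i, P (V i)) -> P (\bigcup_i V i).

Section Cells.
Variables (I : finType) (f : I -> Z -> R).
Hypothesis cf : forall i, continuous (f i).

(** The points where the members of [A] are exactly the largest values of [f],
    in the sense that every value inside [A] is positive and exceeds every value
    outside it. *)
Definition cell (A : {set I}) : set Z := [set z | forall q : I * I,
  q.1 \in A -> 0 < f q.1 z /\ (q.2 \notin A -> f q.2 z < f q.1 z)].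

Lemma cell_open A : open (cell A).
Proof.
rewrite openE => z Az; apply: filter_forall => -[a b] /=.
have [aA|/negP aA] := boolP (a \in A); last by apply: filterE.
have [/= a0 ba] := Az (a, b) aA.
have na : nbhs z [set y | 0 < f a y].
  have na0 : nbhs (f a z) [set x | 0 < x] by exact: lt_nbhsr.
  exact: cf na0.
have [bA|bA] := boolP (b \in A); first by apply: filterS na => y.
have nab : nbhs z [set y | 0 < f a y - f b y].
  have cab : continuous (fun y => f a y - f b y).
    by move=> y; apply: cvgB; exact: cf.
  by apply: (cab z [set x | 0 < x] (lt_nbhsr _)); rewrite subr_gt0; exact: ba.
by apply: filterS2 na nab => y ya yab _; split=> // _; rewrite -subr_gt0.
Qed.

(** If neither set contained the other, a value in [A] and one in [A'] would each
    exceed the other. *)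
Lemma cell_comparable A A' z : cell A z -> cell A' z ->
  A \subset A' \/ A' \subset A.
Proof.
move=> cA cA'; have [|/fintype.subsetPn[a aA aA']] := boolP (A \subset A'); first by left.
right; apply/fintype.subsetP => b bA'; apply: contraT => bA.
have [_ /= /(_ bA) ba] := cA (a, b) aA.
have [_ /= /(_ aA') ab] := cA' (b, a) bA'.
by have := lt_trans ab ba; rewrite ltxx.
Qed.

End Cells.

(** Let [f] be the family of all products of a distance function of the first
    cover with one of the second, and consider its cells indexed by rectangles
    [S * T]. A cell of this kind lies in [U i] and [W j] for [i] in [S] and [j] in
    [T]. Two different rectangles with the same [#|S| + #|T|] are not
    comparable, so their cells are disjoint, and the cells with
    [#|S| + #|T| = k + 2] may be merged into one member of the new cover. Every
    point lies in the cell given by the indices where the two families of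
    distances are maximal, and [k] ranges from 0 to [n + m]. *)
Lemma combine_covers n m (U : 'I_n.+1 -> set Z) (W : 'I_m.+1 -> set Z) :
  (forall i, open (U i)) -> (forall j, open (W j)) ->
  \bigcup_i U i = setT -> \bigcup_j W j = setT ->
  (forall i j, P (U i `&` W j)) ->
  exists C : 'I_(n + m).+1 -> set Z,
    [/\ forall k, open (C k), \bigcup_k C k = setT & forall k, P (C k)].
Proof.
move=> oU oW covU covW PUW.
pose f (q : 'I_n.+1 * 'I_m.+1) z := cozero_fun (U q.1) z * cozero_fun (W q.2) z.
have cf q : continuous (f q).
  by move=> z; apply: cvgM; exact: cozero_fun_continuous.
pose D k (ST : {set 'I_n.+1} * {set 'I_m.+1}) : set Z :=
  [set z | [/\ 0 < #|ST.1|, 0 < #|ST.2| & #|ST.1| + #|ST.2| = k.+2]%N /\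
    cell f (finset.setX ST.1 ST.2) z].
have oD k ST : open (D k ST).
  rewrite openE => z [STk STz].
  have := open_nbhs_nbhs (conj (cell_open cf (finset.setX ST.1 ST.2)) STz).
  by apply: filterS.
have subX (S S' : {set 'I_n.+1}) (T T' : {set 'I_m.+1}) :
    (0 < #|S|)%N -> (0 < #|T|)%N -> finset.setX S T \subset finset.setX S' T' ->
    (S \subset S') && (T \subset T').
  move=> /card_gt0P[i iS] /card_gt0P[j jT] /fintype.subsetP ST.
  apply/andP; split; apply/fintype.subsetP.
    by move=> i' i'S; have := ST (i', j); rewrite !inE i'S jT => /(_ isT)/andP[].
  by move=> j' j'T; have := ST (i, j'); rewrite !inE iS j'T => /(_ isT)/andP[].
have disjD k ST ST' z : D k ST z -> D k ST' z -> ST = ST'.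
  have aux S T S' T' : D k (S, T) z -> D k (S', T') z ->
      finset.setX S T \subset finset.setX S' T' -> (S, T) = (S', T').
    move=> [[/= S0 T0 STk] _] [[/= _ _ ST'k] _] /(subX _ _ _ _ S0 T0)/andP[SS TT].
    have := subset_leq_card SS; have := subset_leq_card TT => cT cS.
    rewrite /= in STk ST'k.
    congr pair; apply/eqP; rewrite eqEcard ?SS ?TT /=.
      by rewrite -(leq_add2r #|T'|) ST'k -STk leq_add2l.
    by rewrite -(leq_add2l #|S'|) ST'k -STk leq_add2r.
  case: ST ST' => [S T] [S' T'] DS DS'.
  have [/= ST|/= ST] := cell_comparable DS.2 DS'.2; first exact: aux.
  by apply/esym; exact: aux.
exists (fun k => \bigcup_ST D k ST); split.
- by move=> k; exact: bigcup_open.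
- rewrite -subTset => z _.
  have amax p (g : 'I_p.+1 -> R) : exists i, forall i', g i' <= g i.
    by exists [arg max_(i > ord0) g i]%O; case: arg_maxP => // i _ + i'; apply.
  have [i0 i0max] := amax n (fun i => cozero_fun (U i) z).
  have [j0 j0max] := amax m (fun j => cozero_fun (W j) z).
  pose S := finset (fun i => [forall i', cozero_fun (U i') z <= cozero_fun (U i) z]).
  pose T := finset (fun j => [forall j', cozero_fun (W j') z <= cozero_fun (W j) z]).
  have i0S : i0 \in S by rewrite inE; apply/forallP.
  have j0T : j0 \in T by rewrite inE; apply/forallP.
  have S0 i : i \in S -> 0 < cozero_fun (U i) z.
    rewrite inE => /forallP iS; have [i' _ Uz] : (\bigcup_i U i) z by rewrite covU.
    by apply: lt_le_trans (iS i'); apply: cozero_fun_gt0.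
  have T0 j : j \in T -> 0 < cozero_fun (W j) z.
    rewrite inE => /forallP jT; have [j' _ Wz] : (\bigcup_j W j) z by rewrite covW.
    by apply: lt_le_trans (jT j'); apply: cozero_fun_gt0.
  have cS : (0 < #|S| <= n.+1)%N.
    apply/andP; split; first by apply/card_gt0P; exists i0.
    by have := max_card (mem S); rewrite card_ord.
  have cT : (0 < #|T| <= m.+1)%N.
    apply/andP; split; first by apply/card_gt0P; exists j0.
    by have := max_card (mem T); rewrite card_ord.
  exists (inord (#|S| + #|T|).-2) => //; exists (S, T) => //; split.
    split => /=; [by apply/card_gt0P; exists i0|by apply/card_gt0P; exists j0|].
    by move: #|S| #|T| cS cT => a b /andP[a0 an] /andP[b0 bm]; rewrite inordK; lia.
  move=> [[i j] [i' j']] /=; rewrite !finset.in_setX /= => /andP[iS jT]; split.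
    by rewrite /f /= mulr_gt0 // ?S0 ?T0.
  move=> nST; rewrite /f /=.
  have Si := S0 i iS; have Tj := T0 j jT.
  have lei : cozero_fun (U i') z <= cozero_fun (U i) z.
    by move: iS; rewrite inE => /forallP.
  have lej : cozero_fun (W j') z <= cozero_fun (W j) z.
    by move: jT; rewrite inE => /forallP.
  have S_up x : cozero_fun (U i) z <= cozero_fun (U x) z -> x \in S.
    move: iS; rewrite !inE => /forallP iS ix; apply/forallP => i''.
    exact: le_trans (iS i'') ix.
  have T_up x : cozero_fun (W j) z <= cozero_fun (W x) z -> x \in T.
    move: jT; rewrite !inE => /forallP jT jx; apply/forallP => j''.
    exact: le_trans (jT j'') jx.
  have Ui' := cozero_fun_ge0 (U i') z; have Wj' := cozero_fun_ge0 (W j') z.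
  have [ii'|i'i] := leP (cozero_fun (U i) z) (cozero_fun (U i') z).
    have [jj'|j'j] := leP (cozero_fun (W j) z) (cozero_fun (W j') z).
      by move: nST; rewrite S_up // T_up.
    by apply: le_lt_trans (ler_wpM2r Wj' lei) _; rewrite ltr_pM2l.
  by apply: le_lt_trans (ler_wpM2l Ui' lej) _; rewrite ltr_pM2r.
- move=> k; apply: P_bigcup => [ST|ST ST' z|[S T]] //; first exact: disjD.
  have [/card_gt0P[i iS]|S0] := boolP (0 < #|S|)%N; last first.
    apply: (P_sub (A := U ord0 `&` W ord0)) => // z [[/= S0' _ _] _].
    by rewrite S0' in S0.
  have [/card_gt0P[j jT]|T0] := boolP (0 < #|T|)%N; last first.
    apply: (P_sub (A := U ord0 `&` W ord0)) => // z [[/= _ T0' _] _].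
    by rewrite T0' in T0.
  apply: (P_sub (A := U i `&` W j)) => // z [_ /(_ ((i, j), (i, j)))] /=.
  rewrite !inE iS jT => /(_ isT)[f0 _]; split; apply: contrapT => nz.
    by rewrite /f /= cozero_fun_out // mul0r ltxx in f0.
  by rewrite /f /= (cozero_fun_out nz) mulr0 ltxx in f0.
Qed.

End CombineCovers.

(** * The inequality *)

Lemma path_section_sub (R : realType) (X : topologicalType) (A A' : set (X * X))
    (s : X * X -> path_space R X) :
  A `<=` A' -> path_section A' s -> path_section A s.
Proof.
move=> AA' [/cont_onP cs es]; split; last by move=> z /AA'; exact: es.
by apply/cont_onP; exact: cont_on_sub cs.
Qed.

Lemma path_section_bigcup (R : realType) (X : topologicalType) (I : Type)
    (V : I -> set (X * X)) :
  (forall i, open (V i)) -> (forall i j z, V i z -> V j z -> i = j) ->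
  (forall i, exists s : X * X -> path_space R X, path_section (V i) s) ->
  exists s : X * X -> path_space R X, path_section (\bigcup_i V i) s.
Proof.
move=> oV disj sec; have [s sV] := @choice _ _ _ sec.
have [|g cg gE] := cont_on_bigcup_disjoint
    (fun z => cst z.1 : path_space R X) oV disj (f := s).
  by move=> i; apply/cont_onP; exact: (sV i).1.
exists g; split; first exact/cont_onP.
by move=> z [i _ Vz]; rewrite (gE i) //; exact: (sV i).2.
Qed.

Lemma ereal_inf_nat (R : realType) (A : set nat) :
  ereal_inf [set (k%:R : R)%:E | k in A] = +oo%E \/
  exists2 n, A n & ereal_inf [set (k%:R : R)%:E | k in A] = (n%:R)%:E.
Proof.
have [[n0 An0]|/forallNP A0] := pselect (exists n, A n); last first.
  left; rewrite (_ : A = set0) ?image_set0 ?ereal_inf0 //.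
  by rewrite -subset0 => n /A0.
right; have exA : exists n, `[< A n >] by exists n0; apply/asboolP.
case: (ex_minnP exA) => n /asboolP An nmin; exists n => //.
apply/eqP; rewrite eq_le; apply/andP; split.
  by apply: ereal_inf_lbound; exists n.
apply: le_ereal_inf_tmp => _ [k Ak <-]; rewrite lee_fin ler_nat.
by apply: nmin; apply/asboolP.
Qed.

Lemma TC_cover_twisted (R : realType) (G : topologicalGroupType)
    (E F : topologicalType) (X B : metricType R)
    (aE : gaction G E) (aF : gaction G F) (p : X -> B) n m :
  locally_trivial aE -> has_structure_group aF aE p ->
  TC_cover R B n -> TCstar_cover R aF m -> TC_cover R X (n + m).
Proof.
move=> trivE [g [cg [h [[ch [h' [ch' hK _]]] hp]]]].
move=> [U [oU covU secU]] [V [oV V_inv covV secV]].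
pose W j := [set z : X * X | fiber_set (V j) (twisted_coord h z.1, twisted_coord h z.2)].
have cp2 : continuous (fun z : X * X => (p z.1, p z.2)).
  apply: cont_onT; apply: cont_on_pair; apply: cont_on_compT (p_continuous ch hp).
    by apply: cont_on_fst; exact: cont_on_id.
  by apply: cont_on_snd; exact: cont_on_id.
apply: (@combine_covers R (X * X)%type
  (fun A => exists s : X * X -> path_space R X, path_section A s) _ _ n m
  (fun i => [set z | U i (p z.1, p z.2)]) W).
- by move=> A A' AA' [s sA]; exists s; exact: path_section_sub sA.
- by move=> I C; exact: path_section_bigcup.
- by move=> i; move/continuousP: cp2; apply; exact: oU.
- by move=> j; apply: fiber_set_coord_open => //; exact: V_inv.
- rewrite -subTset => z _.
  have [i _ Uz] : (\bigcup_i U i) (p z.1, p z.2) by rewrite covU.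
  by exists i.
- rewrite -subTset => z _.
  have [j _ Vz] : (\bigcup_i V i) ((orbit_repr (twisted_coord h z.1)).1,
    (orbit_repr (twisted_coord h z.2)).1) by rewrite covV.
  by exists j.
- move=> i j; have [s sU] := secU i; have [phi [phiV phi_gact]] := secV j.
  exact: (piece_path_section trivE cg ch ch' hK hp (oU i) sU (V_inv j) phiV phi_gact).
Qed.

Theorem theorem3p1 (R : realType) (G : topologicalGroupType)
    (E : topologicalType) (aE : gaction G E)
    (F X B : metricType R) (aF : gaction G F) (p : X -> B) :
  universal_gspace R aE ->
  locally_compact [set: F] -> proper_gaction aF ->
  locally_compact [set: X] -> ANR R X ->
  locally_compact [set: B] -> ANR R B ->
  fiber_bundle F p -> has_structure_group aF aE p ->
  (TC R X <= TC R B + TCstar R aF)%E.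
Proof.
move=> [/numerable_free_locally_trivial trivE _] _ _ _ _ _ _ _ structp.
rewrite /TC /TCstar.
have inf_ge0 A : (0 <= ereal_inf [set (k%:R : R)%:E | k in A])%E.
  by apply: le_ereal_inf_tmp => _ [k _ <-]; rewrite lee_fin.
have [->|[n covB ->]] := ereal_inf_nat R (TC_cover R B).
  by rewrite addye ?leey // gt_eqF // (lt_le_trans _ (inf_ge0 _)).
have [->|[m covF ->]] := ereal_inf_nat R (TCstar_cover R aF).
  by rewrite addey ?leey.
rewrite -EFinD -natrD; apply: ereal_inf_lbound; exists (n + m)%N => //.
exact: TC_cover_twisted structp covB covF.
Qed.
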